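(* Let $k\ge2$, $\theta\in(0,1]$, and let $P=\sum_{i=0}^{s}a_i(1-P_1)^{b_i}P_2^{c_i}$ with real $a_i$ and nonnegative integers $b_i,c_i$, and $F$ as in the context. Then $$\widetilde{L}_k(F)=\sum_{0\le i,j\le s}a_ia_j\sum_{c_1'=0}^{c_i}\sum_{c_2'=0}^{c_j}\binom{c_i}{c_1'}\binom{c_j}{c_2'}Q_{c_1'+c_2'}(k-1)\Bigg(\sum_{d_1=0}^{\tilde d}\frac{(-1)^{d_1}\binom{\tilde d}{d_1}\delta_{i,j,c_1',c_2'}\lambda_{k-1+d_1+2c_1'+2c_2'}}{(k+2c_1'+2c_2'-2)!\,(k-1+2c_1'+2c_2'+d_1)}$$ $$-\sum_{b_1'=0}^{b_i}\sum_{e_1=0}^{\tilde e}\frac{(-1)^{e_1+b_1'}\binom{\tilde e}{e_1}\binom{b_i}{b_1'}\varepsilon_{i,j,c_1',c_2',b_1'}\,\mu_{b_1'+2c_i-2c_1'+1,\ k-1+e_1+2c_1'+2c_2'}}{(k+2c_1'+2c_2'-2)!\,(k-1+2c_1'+2c_2'+e_1)}\Bigg)$$ and $$\widetilde{M}_k(F)=\frac{\theta}{2}\sum_{0\le i,j\le s}a_ia_j\sum_{c_1'=0}^{c_i}\sum_{c_2'=0}^{c_j}\binom{c_i}{c_1'}\binom{c_j}{c_2'}Q_{c_1'+c_2'}(k-1)\Bigg(\sum_{d_1=0}^{\tilde d}\frac{(-1)^{d_1}\binom{\tilde d}{d_1}\delta_{i,j,c_1',c_2'}\lambda_{k-1+d_1+2c_1'+2c_2'}}{(k+2c_1'+2c_2'-2)!\,(k-1+2c_1'+2c_2'+d_1)}$$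 $$-2\sum_{b_1'=0}^{b_i}\sum_{e_1=0}^{\tilde e}\frac{(-1)^{e_1+b_1'}\binom{\tilde e}{e_1}\binom{b_i}{b_1'}\varepsilon_{i,j,c_1',c_2',b_1'}\,\mu_{b_1'+2c_i-2c_1'+1,\ k-1+e_1+2c_1'+2c_2'}}{(k+2c_1'+2c_2'-2)!\,(k-1+2c_1'+2c_2'+e_1)}$$ $$+\sum_{b_1'=0}^{b_i}\sum_{b_2'=0}^{b_j}\sum_{f_1=0}^{\tilde f}\frac{(-1)^{f_1+b_1'+b_2'}\binom{\tilde f}{f_1}\binom{b_i}{b_1'}\binom{b_j}{b_2'}\,\mu_{2c_i+2c_j-2c_1'-2c_2'+b_1'+b_2'+2,\ k-1+f_1+2c_1'+2c_2'}}{\zeta_{i,j,c_1',c_2',b_1',b_2'}\,(k+2c_1'+2c_2'-2)!\,(k-1+2c_1'+2c_2'+f_1)}\Bigg),$$ where $\tilde d=b_i+b_j+2c_i+2c_j-2c_1'-2c_2'+2$, $\tilde e=b_i-b_1'+b_j+2c_j-2c_2'+1$, $\tilde f=b_i+b_j-b_1'-b_2'$, $$\delta_{i,j,c_1',c_2'}=\frac{b_i!\,b_j!\,(2c_i-2c_1')!\,(2c_j-2c_2')!}{(b_i+2c_i-2c_1'+1)!\,(b_j+2c_j-2c_2'+1)!},\quad \varepsilon_{i,j,c_1',c_2',b_1'}=\frac{b_j!\,(2c_j-2c_2')!}{(b_j+2c_j-2c_2'+1)!\,(b_1'+2c_i-2c_1'+1)},$$ $$\zeta_{i,j,c_1',c_2',b_1',b_2'}=(b_1'+2c_i-2c_1'+1)(b_2'+2c_j-2c_2'+1),$$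 $$\lambda_m=\frac{\theta}{2}\left(\frac{\theta}{2}\frac{{}_2F_1(1,1;m+2;\theta/2)}{m+1}-H_m+\log\left(1-\frac{\theta}{2}\right)\right),\qquad \mu_{m,n}=\frac{\theta}{2}\frac{{}_2F_1(1,m;m+n+1;\theta/2)}{m\binom{m+n}{n}},$$ with ${}_2F_1$ the Gauss hypergeometric function and $H_m$ the $m$-th harmonic number. (In particular the limits defining $\widetilde{L}_k(F)$ and $\widetilde{M}_k(F)$ exist.)
   Context: $P_i=x_1^i+\cdots+x_k^i$ denotes the $i$-th power sum symmetric polynomial in $k$ variables. $\mathcal{R}_k=\{(x_1,\dots,x_k): x_i\ge0,\ \sum x_i\le1\}$. $F:\mathbb{R}^k\to\mathbb{R}$ equals $P(x_1,\dots,x_k)$ on $\mathcal{R}_k$ and $0$ outside. $Q_0(x)=1$ and for $c\ge1$, $Q_c(x)=c!\sum_{r=1}^{c}\binom{x}{r}\sum_{c_1+\cdots+c_r=c,\ c_j\ge1}\prod_{j=1}^r\frac{(2c_j)!}{c_j!}$. For $0<\eta<\theta/2$ define $F_\xi(x_1,\dots,x_k)=F\big(\tfrac{2\xi}{\theta}+(1-\tfrac{2\xi}{\theta})x_1,x_2,\dots,x_k\big)$ and $J_k(F)=\int_0^1\!\cdots\!\int_0^1\left(\int_0^1F\,dx_1\right)^2dx_2\cdots dx_k$, $L_k(F)=\int_\eta^{\theta/2}\frac{\theta/2-\xi}{\xi(1-\xi)}\int_0^1\!\cdots\!\int_0^1\left(\int_0^1F_\xi\,dx_1\right)\left(\int_0^1F\,dx_1\right)dx_2\cdots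 dx_k\,d\xi$, $M_k(F)=\int_\eta^{\theta/2}\frac{(\theta/2-\xi)^2}{\xi(1-\xi)}\int_0^1\!\cdots\!\int_0^1\left(\int_0^1F_\xi\,dx_1\right)^2dx_2\cdots dx_k\,d\xi$ (these depend on $\eta$). Define $\widetilde{L}_k(F)=\lim_{\eta\to0^+}\Big(L_k(F)-\frac{\theta}{2}\log\Big(\frac{1-\eta}{\eta(\frac2\theta-1)}\Big)J_k(F)\Big)$ and $\widetilde{M}_k(F)=\lim_{\eta\to0^+}\Big(M_k(F)-\frac{\theta^2}{4}\log\Big(\frac{1-\eta}{\eta(\frac2\theta-1)}\Big)J_k(F)\Big)$. *)

(* Defs.v *)
From Stdlib Require Import Reals Lra Lia ClassicalEpsilon Factorial Binomial.
From Coquelicot Require Import Coquelicot.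
Open Scope R_scope.

Fixpoint sumR (n : nat) (f : nat -> R) : R :=
  match n with
  | O => f O
  | S n' => sumR n' f + f n
  end.

(* Points of R^k are functions x : nat -> R; coordinates x_1,...,x_k are x 0,...,x (k-1). *)
Definition powsum (k i : nat) (x : nat -> R) : R :=
  match k with O => 0 | S k' => sumR k' (fun l => x l ^ i) end.

Definition in_simplex (k : nat) (x : nat -> R) : Prop :=
  (forall l, (l < k)%nat -> 0 <= x l) /\ powsum k 1 x <= 1.

Definition Ppoly (k s : nat) (a : nat -> R) (b c : nat -> nat) (x : nat -> R) : R :=
  sumR s (fun i => a i * (1 - powsum k 1 x) ^ (b i) * (powsum k 2 x) ^ (c i)).

Definition Ffun (k s : nat) (a : nat -> R) (b c : nat -> nat) (x : nat -> R) : R :=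
  if excluded_middle_informative (in_simplex k x) then Ppoly k s a b c x else 0.

Definition vcons (t : R) (y : nat -> R) : nat -> R :=
  fun i => match i with O => t | S i' => y i' end.

Fixpoint iint (n : nat) (g : (nat -> R) -> R) : R :=
  match n with
  | O => g (fun _ => 0)
  | S n' => RInt (fun t => iint n' (fun y => g (vcons t y))) 0 1
  end.

Definition innerF k s a b c (y : nat -> R) : R :=
  RInt (fun t => Ffun k s a b c (vcons t y)) 0 1.

Definition innerFxi k s a b c (theta xi : R) (y : nat -> R) : R :=
  RInt (fun t => Ffun k s a b c (vcons (2 * xi / theta + (1 - 2 * xi / theta) * t) y)) 0 1.

Definition Jk k s a b c : R :=
  iint (k - 1) (fun y => (innerF k s a b c y) ^ 2).

Definition Lk k s a b c (theta eta : R) : R :=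
  RInt (fun xi => (theta / 2 - xi) / (xi * (1 - xi)) *
          iint (k - 1) (fun y => innerFxi k s a b c theta xi y * innerF k s a b c y))
       eta (theta / 2).

Definition Mk k s a b c (theta eta : R) : R :=
  RInt (fun xi => (theta / 2 - xi) ^ 2 / (xi * (1 - xi)) *
          iint (k - 1) (fun y => (innerFxi k s a b c theta xi y) ^ 2))
       eta (theta / 2).

Fixpoint fallpow (x : R) (r : nat) : R :=
  match r with O => 1 | S r' => fallpow x r' * (x - INR r') end.
Definition genbinom (x : R) (r : nat) : R := fallpow x r / INR (fact r).

(* compS r c = sum over (c_1,...,c_r), c_j >= 1, c_1+...+c_r = c, of prod_j (2c_j)!/c_j! *)
Fixpoint compS (r c : nat) : R :=
  match r with
  | O => if Nat.eqb c 0 then 1 else 0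
  | S r' => match c with
            | O => 0
            | S c' => sumR c' (fun m => (* c_1 = m+1 *)
                        INR (fact (2 * (S m))) / INR (fact (S m)) * compS r' (c - S m))
            end
  end.

Definition Qc (c : nat) (x : R) : R :=
  match c with
  | O => 1
  | S c' => INR (fact c) * sumR c' (fun r =>
              genbinom x (S r) * compS (S r) c)
  end.

Fixpoint rising (a : R) (n : nat) : R :=
  match n with O => 1 | S n' => rising a n' * (a + INR n') end.

Definition hyp2F1 (a b c z : R) : R :=
  Series (fun n => rising a n * rising b n / rising c n * z ^ n / INR (fact n)).

Definition harm (m : nat) : R :=
  match m with O => 0 | S m' => sumR m' (fun i => / INR (S i)) end.

Definition lam (theta : R) (m : nat) : R :=
  theta / 2 * (theta / 2 * hyp2F1 1 1 (INR m + 2) (theta / 2) / (INR m + 1)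
               - harm m + ln (1 - theta / 2)).

Definition mu (theta : R) (m n : nat) : R :=
  theta / 2 * hyp2F1 1 (INR m) (INR m + INR n + 1) (theta / 2)
  / (INR m * Binomial.C (m + n) n).

Definition fR (n : nat) : R := INR (fact n).

Section Formula.
Variables (k s : nat) (a : nat -> R) (b c : nat -> nat) (theta : R).

Definition dtil i j c1 c2 : nat := b i + b j + (2 * c i - 2 * c1) + (2 * c j - 2 * c2) + 2.
Definition etil i j c2 b1 : nat := (b i - b1) + b j + (2 * c j - 2 * c2) + 1.
Definition ftil i j b1 b2 : nat := (b i - b1) + (b j - b2).

Definition delta i j c1 c2 : R :=
  fR (b i) * fR (b j) * fR (2 * c i - 2 * c1) * fR (2 * c j - 2 * c2)
  / (fR (b i + (2 * c i - 2 * c1) + 1) * fR (b j + (2 * c j - 2 * c2) + 1)).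

Definition eps i j c1 c2 b1 : R :=
  fR (b j) * fR (2 * c j - 2 * c2)
  / (fR (b j + (2 * c j - 2 * c2) + 1) * INR (b1 + (2 * c i - 2 * c1) + 1)).

Definition zeta i j c1 c2 b1 b2 : R :=
  INR (b1 + (2 * c i - 2 * c1) + 1) * INR (b2 + (2 * c j - 2 * c2) + 1).

Definition NN c1 c2 : nat := k - 1 + 2 * c1 + 2 * c2.
Definition DD c1 c2 : R := fR (k + 2 * c1 + 2 * c2 - 2).

Definition term1 i j c1 c2 : R :=
  sumR (dtil i j c1 c2) (fun d1 =>
    (-1) ^ d1 * Binomial.C (dtil i j c1 c2) d1 * delta i j c1 c2 * lam theta (NN c1 c2 + d1)
    / (DD c1 c2 * INR (NN c1 c2 + d1))).

Definition term2 i j c1 c2 : R :=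
  sumR (b i) (fun b1 => sumR (etil i j c2 b1) (fun e1 =>
    (-1) ^ (e1 + b1) * Binomial.C (etil i j c2 b1) e1 * Binomial.C (b i) b1
    * eps i j c1 c2 b1 * mu theta (b1 + (2 * c i - 2 * c1) + 1) (NN c1 c2 + e1)
    / (DD c1 c2 * INR (NN c1 c2 + e1)))).

Definition term3 i j c1 c2 : R :=
  sumR (b i) (fun b1 => sumR (b j) (fun b2 => sumR (ftil i j b1 b2) (fun f1 =>
    (-1) ^ (f1 + b1 + b2) * Binomial.C (ftil i j b1 b2) f1 * Binomial.C (b i) b1
    * Binomial.C (b j) b2
    * mu theta ((2 * c i - 2 * c1) + (2 * c j - 2 * c2) + b1 + b2 + 2) (NN c1 c2 + f1)
    / (zeta i j c1 c2 b1 b2 * DD c1 c2 * INR (NN c1 c2 + f1))))).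

Definition outer (br : nat -> nat -> nat -> nat -> R) : R :=
  sumR s (fun i => sumR s (fun j =>
    a i * a j * sumR (c i) (fun c1 => sumR (c j) (fun c2 =>
      Binomial.C (c i) c1 * Binomial.C (c j) c2 * Qc (c1 + c2) (INR k - 1)
      * br i j c1 c2)))).

Definition Ltilde_formula : R :=
  outer (fun i j c1 c2 => term1 i j c1 c2 - term2 i j c1 c2).

Definition Mtilde_formula : R :=
  theta / 2 * outer (fun i j c1 c2 => term1 i j c1 c2 - 2 * term2 i j c1 c2 + term3 i j c1 c2).

End Formula.

(* Main.v *)
Require Import Defs.
From Stdlib Require Import Reals Lra Lia ClassicalEpsilon.
From Coquelicot Require Import Coquelicot.
Open Scope R_scope.

(* Put [z = theta/2] and [u = xi/z]. For [y] in the open unit cube with coordinate sum [sg] and sum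
   of squares [q], the inner integral of [F_xi] is [1/(1-u)] times the integral of [F] over
   [u <= t <= 1 - sg]; this is a sum of terms [q^c * g(sg)] with [g] continuous and vanishing on
   [1, oo). A Dirichlet-type formula, by induction on the dimension, turns the integral of such a
   term over the unit [n]-cube into [Q_c(n) / (n+2c-1)!] times the integral of [r^(n+2c-1) g(r)].
   Hence [L_k] and [M_k] are, up to a power of [z], integrals of [E(u) / (xi (1-xi))] with [E] an
   explicit polynomial on [0, 1] and [E(0) = J_k]. As the logarithm is the integral of
   [1 / (xi (1-xi))], the regularised quantities are integrals of [(E(u) - E(0)) / (xi (1-xi))],
   which converge at [0]. Finally [E(0) - E(u)] is a combination of [1 - (1-u)^m] and
   [u^m (1-u)^n], whose integrals against [z / (u (1-zu))] are [- lambda_m] and [mu_(m,n)]. *)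

Local Arguments INR : simpl never.

(** * Finite sums and beta integrals *)

Lemma sumR_ext (n : nat) (f g : nat -> R) :
  (forall i, (i <= n)%nat -> f i = g i) -> sumR n f = sumR n g.
Proof.
  induction n as [|n IH]; intros H; simpl.
  - apply H; lia.
  - rewrite IH, (H (S n)); try lia; auto.
Qed.

Lemma sumR_scal (n : nat) (x : R) (f : nat -> R) :
  sumR n (fun i => x * f i) = x * sumR n f.
Proof. induction n as [|n IH]; simpl; [ring | rewrite IH; ring]. Qed.

Lemma sumR_plus (n : nat) (f g : nat -> R) :
  sumR n (fun i => f i + g i) = sumR n f + sumR n g.
Proof. induction n as [|n IH]; simpl; [ring | rewrite IH; ring]. Qed.

Lemma sumR_opp (n : nat) (f : nat -> R) : sumR n (fun i => - f i) = - sumR n f.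
Proof. induction n as [|n IH]; simpl; [ring | rewrite IH; ring]. Qed.

Lemma sumR_0 (n : nat) : sumR n (fun _ => 0) = 0.
Proof. induction n as [|n IH]; simpl; [ring | rewrite IH; ring]. Qed.

Lemma sumR_succ (n : nat) (f : nat -> R) : sumR (S n) f = sumR n f + f (S n).
Proof. reflexivity. Qed.

Lemma sumR_shift (n : nat) (f : nat -> R) :
  sumR (S n) f = f O + sumR n (fun i => f (S i)).
Proof.
  induction n as [|n IH]; [simpl; ring|].
  rewrite sumR_succ, IH; simpl; ring.
Qed.

Lemma sumR_rev (n : nat) (f : nat -> R) :
  sumR n f = sumR n (fun i => f (n - i)%nat).
Proof.
  induction n as [|n IH]; [reflexivity|].
  rewrite (sumR_shift n (fun i => f (S n - i)%nat)); simpl.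
  rewrite IH; ring.
Qed.

Lemma sumR_swap (n m : nat) (f : nat -> nat -> R) :
  sumR n (fun i => sumR m (fun j => f i j)) = sumR m (fun j => sumR n (fun i => f i j)).
Proof.
  induction n as [|n IH]; simpl; [reflexivity|].
  rewrite IH, <- sumR_plus; reflexivity.
Qed.

Lemma sumR_mult (n m : nat) (f g : nat -> R) :
  sumR n f * sumR m g = sumR n (fun i => sumR m (fun j => f i * g j)).
Proof.
  induction n as [|n IH]; simpl.
  - now rewrite sumR_scal.
  - rewrite <- IH, sumR_scal; ring.
Qed.

Lemma binomial_sumR (x y : R) (n : nat) :
  (x + y) ^ n = sumR n (fun i => Binomial.C n i * x ^ i * y ^ (n - i)).
Proof.
  rewrite binomial.
  enough (H : forall f m, sum_f_R0 f m = sumR m f) by apply H.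
  intros f m; induction m as [|m IH]; simpl; [reflexivity | now rewrite IH].
Qed.

(** One notion of linearity serves ordinary integrals, iterated integrals and regularised integrals,
    so that finite sums are handled by a single lemma. *)
Definition linear_rel {X : Type} (P : (X -> R) -> R -> Prop) : Prop :=
  (forall f g u v, P f u -> P g v -> P (fun x => f x + g x) (u + v)) /\
  (forall c f u, P f u -> P (fun x => c * f x) (c * u)).

Lemma sumR_rel {X : Type} (P : (X -> R) -> R -> Prop) (n : nat)
  (f : nat -> X -> R) (v : nat -> R) :
  linear_rel P -> (forall i, (i <= n)%nat -> P (f i) (v i)) ->
  P (fun x => sumR n (fun i => f i x)) (sumR n v).
Proof.
  intros [Hp Hs]; induction n as [|n IH]; intros H; simpl.
  - apply H; lia.
  - apply (Hp (fun x => sumR n (fun i => f i x)) (f (S n))).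
    + apply IH; intros i Hi; apply H; lia.
    + apply H; lia.
Qed.

Lemma is_RInt_Rplus (f g : R -> R) (a b u v : R) :
  is_RInt f a b u -> is_RInt g a b v -> is_RInt (fun x => f x + g x) a b (u + v).
Proof. exact (is_RInt_plus f g a b u v). Qed.

Lemma linear_rel_RInt (a b : R) : linear_rel (fun f v => is_RInt f a b v).
Proof.
  split.
  - intros f g u v Hf Hg; exact (is_RInt_plus f g a b u v Hf Hg).
  - intros c f u Hf; exact (is_RInt_scal f a b c u Hf).
Qed.

Lemma is_RInt_chain (f : R -> R) (a b c u v : R) :
  is_RInt f a b u -> is_RInt f b c v -> is_RInt f a c (u + v).
Proof. exact (is_RInt_Chasles f a b c u v). Qed.

Lemma is_RInt_flip (f : R -> R) (a b v : R) : is_RInt f b a v -> is_RInt f a b (- v).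
Proof. exact (is_RInt_swap f a b v). Qed.

Lemma fR_S (n : nat) : fR (S n) = INR (S n) * fR n.
Proof. unfold fR; rewrite fact_simpl, mult_INR; reflexivity. Qed.

Lemma fR_neq0 (n : nat) : fR n <> 0.
Proof. apply INR_fact_neq_0. Qed.

Lemma is_RInt_ext_all (f g : R -> R) (a b v : R) :
  (forall t, f t = g t) -> is_RInt f a b v -> is_RInt g a b v.
Proof. intros H; apply is_RInt_ext; intros t _; apply H. Qed.

Lemma is_RInt_ext_open (f g : R -> R) (a b v : R) :
  a <= b -> (forall t, a < t < b -> f t = g t) -> is_RInt f a b v -> is_RInt g a b v.
Proof.
  intros Hab H; apply is_RInt_ext; intros t.
  rewrite Rmin_left, Rmax_right by lra; apply H.
Qed.

Lemma is_RInt_antideriv (F f : R -> R) (a b v : R) :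
  (forall t, is_derive F t (f t)) -> (forall t, continuous f t) -> F b - F a = v ->
  is_RInt f a b v.
Proof.
  intros HF Hf <-; apply (is_RInt_derive F f); auto.
Qed.

Lemma is_RInt_pow0 (n : nat) (u : R) :
  is_RInt (fun t => t ^ n) 0 u (u ^ S n / INR (S n)).
Proof.
  replace (u ^ S n / INR (S n)) with (u ^ S n / INR (S n) - 0 ^ S n / INR (S n)).
  - apply is_RInt_pow.
  - simpl pow; unfold Rdiv; ring.
Qed.

(** Euler's beta integral. The induction on [b] is for all [m] at once, since each step moves one
    power from [v - t] to [t]. *)
Lemma is_RInt_beta (v : R) (b m : nat) :
  is_RInt (fun t => (v - t) ^ b * t ^ m) 0 v (fR b * fR m / fR (b + m + 1) * v ^ (b + m + 1)).
Proof.
  revert m; induction b as [|b IH]; intros m.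
  - replace (fR 0 * fR m / fR (0 + m + 1) * v ^ (0 + m + 1)) with (v ^ S m / INR (S m)).
    + apply (is_RInt_ext (fun t => t ^ m)); [intros; simpl; ring | apply is_RInt_pow0].
    + replace (0 + m + 1)%nat with (S m) by lia.
      rewrite fR_S; change (fR 0) with 1.
      field; split; [apply fR_neq0 | apply not_0_INR; lia].
  - (* integration by parts *)
    assert (H0 : is_RInt (fun t => (v - t) ^ S b * t ^ m
                       - INR (S b) / INR (S m) * ((v - t) ^ b * t ^ S m)) 0 v 0).
    { apply (is_RInt_antideriv (fun t => (v - t) ^ S b * t ^ S m / INR (S m))).
      - intros t; auto_derive; [exact I|].
        change (pred (S b)) with b; change (pred (S m)) with m.
        simpl pow; fold (v - t); field. apply not_0_INR; lia.
      - intros t; apply (ex_derive_continuous (fun t => (v - t) ^ S b * t ^ m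
                       - INR (S b) / INR (S m) * ((v - t) ^ b * t ^ S m))); auto_derive; exact I.
      - simpl; unfold Rdiv; ring. }
    generalize (is_RInt_plus _ _ _ _ _ _ H0
                 (is_RInt_scal _ _ _ (INR (S b) / INR (S m)) _ (IH (S m)))).
    intros H. replace (fR (S b) * fR m / fR (S b + m + 1) * v ^ (S b + m + 1)) with
      (plus 0 (scal (INR (S b) / INR (S m)) (fR b * fR (S m) / fR (b + S m + 1) * v ^ (b + S m + 1)))).
    + apply (is_RInt_ext (fun t => plus ((v - t) ^ S b * t ^ m
             - INR (S b) / INR (S m) * ((v - t) ^ b * t ^ S m))
             (scal (INR (S b) / INR (S m)) ((v - t) ^ b * t ^ S m)))); [|exact H].
      intros t _; unfold plus, scal; simpl; unfold mult; simpl; ring.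
    + unfold plus, scal; simpl AbelianMonoid.sort; unfold mult; cbn -[fR pow INR Nat.add].
      replace (S b + m + 1)%nat with (b + S m + 1)%nat by lia.
      rewrite (fR_S b), (fR_S m). field.
      split; [apply fR_neq0 | apply not_0_INR; lia].
Qed.

(** The incomplete beta integral as an explicit polynomial. All alternating binomial sums in the
    final formulas come from it. *)
Definition beta_expand (v : R) (b m : nat) (u : R) : R :=
  sumR b (fun j => Binomial.C b j * (-1) ^ j * v ^ (b - j) * (u ^ (m + j + 1) / INR (m + j + 1))).

Lemma is_RInt_beta_expand (v : R) (b m : nat) (u : R) :
  is_RInt (fun t => (v - t) ^ b * t ^ m) 0 u (beta_expand v b m u).
Proof.
  apply (is_RInt_ext (fun t => sumR b (fun j => Binomial.C b j * (-1) ^ j * v ^ (b - j) * t ^ (m + j)))).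
  - intros t _. replace (v - t) with (- 1 * t + v) by ring.
    rewrite binomial_sumR, Rmult_comm, <- sumR_scal.
    apply sumR_ext; intros j _. rewrite Rpow_mult_distr, pow_add; ring.
  - apply (sumR_rel (fun f w => is_RInt f 0 u w)); [apply linear_rel_RInt|].
    intros j _. apply (proj2 (linear_rel_RInt 0 u)).
    rewrite Nat.add_1_r; apply is_RInt_pow0.
Qed.

(** The complete beta integral over [[0, 1]], evaluated in closed form and by binomial expansion. *)
Lemma beta_sum (b m : nat) :
  sumR b (fun j => Binomial.C b j * (-1) ^ j / INR (m + j + 1)) = fR b * fR m / fR (b + m + 1).
Proof.
  generalize (is_RInt_unique _ _ _ _ (is_RInt_beta 1 b m)).
  rewrite (is_RInt_unique _ _ _ _ (is_RInt_beta_expand 1 b m 1)).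
  rewrite pow1, Rmult_1_r; intros <-; unfold beta_expand.
  apply sumR_ext; intros j _; rewrite !pow1; unfold Rdiv; ring.
Qed.

(** * The polynomials [Q_c] and the Dirichlet integral *)

Lemma genbinom_pascal (x : R) (r : nat) :
  genbinom (x + 1) (S r) = genbinom x (S r) + genbinom x r.
Proof.
  assert (H : fallpow (x + 1) (S r) = (x + 1) * fallpow x r).
  { induction r as [|r IH]; [simpl; change (INR 0) with 0; ring|].
    change (fallpow (x + 1) (S (S r))) with (fallpow (x + 1) (S r) * (x + 1 - INR (S r))).
    rewrite IH, S_INR; simpl; ring. }
  unfold genbinom; rewrite H, fact_simpl, mult_INR; simpl fallpow.
  rewrite S_INR; field.
  split; [apply INR_fact_neq_0 | rewrite <- S_INR; apply not_0_INR; lia].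
Qed.

Lemma compS_succ (r c : nat) :
  compS (S r) (S c) = sumR c (fun m => fR (2 * S m) / fR (S m) * compS r (c - m)).
Proof. reflexivity. Qed.

(** There is no composition of [c] into more than [c] positive parts; this lets the sums over [r] be
    padded. *)
Lemma compS_gt (r c : nat) : (c < r)%nat -> compS r c = 0.
Proof.
  revert c; induction r as [|r IH]; intros c H; [lia|].
  destruct c as [|c]; [reflexivity|]; rewrite compS_succ.
  rewrite <- (sumR_0 c); apply sumR_ext; intros m Hm.
  rewrite IH by lia; ring.
Qed.

(** Starting at [r = 0] covers [c = 0] as well: [compS 0 c] is 1 there and 0 for positive [c]. The
    free bound [M] allows sums for different [c] to share one range. *)
Lemma Qc_expand (M c : nat) (x : R) : (c <= M)%nat ->
  Qc c x = fR c * sumR M (fun r => genbinom x r * compS r c).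
Proof.
  intros H.
  assert (E : sumR M (fun r => genbinom x r * compS r c)
              = sumR c (fun r => genbinom x r * compS r c)).
  { induction M as [|M IH]; [replace c with O by lia; reflexivity|].
    destruct (Nat.eq_dec c (S M)) as [->|Hc]; [reflexivity|].
    rewrite sumR_succ, IH, (compS_gt (S M)) by lia; ring. }
  rewrite E; destruct c as [|c].
  - unfold Qc, fR, genbinom; simpl; change (INR 1) with 1; field.
  - rewrite sumR_shift; unfold Qc; fold (fR (S c)); simpl (compS 0 _); ring.
Qed.

(** The recursion in the number of variables: the new variable takes [c - j] of the [c] factors of
    the second power sum and contributes the factorial of its exponent [2 * (c - j)]. *)
Lemma Qc_succ (c : nat) (x : R) :
  Qc c (x + 1) = sumR c (fun j => Binomial.C c j * fR (2 * (c - j)) * Qc j x).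
Proof.
  set (q := fun c => sumR c (fun r => genbinom x r * compS r c)).
  assert (HQ : forall j, Qc j x = fR j * q j) by (intros j; apply Qc_expand; lia).
  (* Pascal's rule in [x], then the recursion of [compS] on the first part of the composition *)
  assert (H : Qc c (x + 1) = fR c * sumR c (fun m => fR (2 * m) / fR m * q (c - m)%nat)).
  { rewrite (Qc_expand (S c)), sumR_shift by lia; f_equal.
    transitivity (q c + sumR c (fun r => genbinom x r * compS (S r) c)).
    { rewrite (sumR_ext c _ (fun r => genbinom x (S r) * compS (S r) c + genbinom x r * compS (S r) c))
        by (intros r _; rewrite genbinom_pascal; ring).
      rewrite sumR_plus; unfold q.
      replace (sumR c (fun r => genbinom x r * compS r c))
        with (sumR (S c) (fun r => genbinom x r * compS r c))
        by (rewrite sumR_succ, (compS_gt (S c) c) by lia; ring).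
      rewrite (sumR_shift c (fun r => genbinom x r * compS r c)).
      change (genbinom x 0) with (genbinom (x + 1) 0); ring. }
    destruct c as [|c].
    - simpl; unfold q, fR; simpl; change (INR 1) with 1; field.
    - rewrite (sumR_shift c (fun m => fR (2 * m) / fR m * q (S c - m)%nat)).
      f_equal; [unfold fR; simpl; change (INR 1) with 1; field|].
      rewrite (sumR_ext _ _ (fun r => sumR c (fun m =>
        fR (2 * S m) / fR (S m) * (genbinom x r * compS r (c - m))))).
      2:{ intros r _; rewrite compS_succ, <- sumR_scal; apply sumR_ext; intros m _; ring. }
      rewrite sumR_swap; apply sumR_ext; intros m Hm; rewrite sumR_scal; f_equal.
      (* The two sums have different upper bounds; after multiplication by the factorial both are
         [Qc (c - m) x]. *)
      apply (Rmult_eq_reg_l (fR (c - m))); [|apply fR_neq0].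
      rewrite <- (Qc_expand (S c) (c - m)) by lia; apply HQ. }
  rewrite H, sumR_rev, <- sumR_scal; apply sumR_ext; intros j Hj.
  replace (c - (c - j))%nat with j by lia.
  rewrite HQ; unfold Binomial.C; fold (fR c) (fR j) (fR (c - j)).
  field; split; apply fR_neq0.
Qed.

(** For positive [r] the falling factorial of 0 contains the factor 0. *)
Lemma Qc_0 (c : nat) : (0 < c)%nat -> Qc c 0 = 0.
Proof.
  destruct c as [|c]; intros Hc; [lia|]; unfold Qc.
  rewrite (sumR_ext _ _ (fun _ => 0)); [rewrite sumR_0; ring|].
  intros r _; unfold genbinom.
  replace (fallpow 0 (S r)) with 0; [unfold Rdiv; ring|].
  induction r as [|r IH]; [simpl; unfold INR; ring|].
  change (fallpow 0 (S (S r))) with (fallpow 0 (S r) * (0 - INR (S r))).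
  rewrite <- IH; ring.
Qed.

Lemma Qc_1 (c : nat) : Qc c 1 = fR (2 * c).
Proof.
  replace 1 with (0 + 1) by ring; rewrite Qc_succ.
  destruct c as [|c]; [unfold fR, Binomial.C; simpl; change (INR 1) with 1; field|].
  rewrite sumR_shift, (sumR_ext _ _ (fun _ => 0)), sumR_0.
  - unfold Binomial.C; rewrite Nat.sub_0_r; simpl (Qc 0 0); fold (fR 0) (fR (S c)).
    change (fR 0) with 1; field; apply fR_neq0.
  - intros i _; rewrite (Qc_0 (S i)) by lia; ring.
Qed.

Lemma ex_RInt_cont (f : R -> R) (a b : R) : (forall t, continuous f t) -> ex_RInt f a b.
Proof. intros H; apply (ex_RInt_continuous f); auto. Qed.

Lemma is_RInt_cont (f : R -> R) (a b : R) :
  (forall t, continuous f t) -> is_RInt f a b (RInt f a b).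
Proof. intros H; apply (RInt_correct f), ex_RInt_cont, H. Qed.

Lemma continuous_pow (n : nat) (t : R) : continuous (fun t : R => t ^ n) t.
Proof. apply (ex_derive_continuous (fun t => t ^ n)); auto_derive; exact I. Qed.

Lemma continuous_Rmult (f g : R -> R) (t : R) :
  continuous f t -> continuous g t -> continuous (fun t => f t * g t) t.
Proof. exact (continuous_mult f g t). Qed.

Lemma continuous_Rplus (f g : R -> R) (t : R) :
  continuous f t -> continuous g t -> continuous (fun t => f t + g t) t.
Proof. exact (continuous_plus f g t). Qed.

(** Integration by parts: [t ^ S m / INR (S m) * RInt h t 1] vanishes at both ends, at 0 by the
    power and at 1 by the empty integral. *)
Lemma is_RInt_pow_tail (h : R -> R) (m : nat) : (forall t, continuous h t) ->
  is_RInt (fun t => t ^ m * RInt h t 1) 0 1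
          (RInt (fun s => s ^ S m * h s) 0 1 / INR (S m)).
Proof.
  intros Hh.
  assert (Hn : INR (S m) <> 0) by (apply not_0_INR; lia).
  assert (Hc : forall t, continuous (fun s => s ^ S m * h s) t)
    by (intros t; apply continuous_Rmult; auto using continuous_pow).
  assert (Hd : forall t, is_derive (fun t => RInt h t 1) t (- h t)).
  { intros t; apply (is_derive_RInt' h _ t 1); auto.
    apply filter_forall; intros s; now apply is_RInt_cont. }
  assert (HdP : forall t, is_derive (fun t => t ^ S m / INR (S m) * RInt h t 1) t
            (t ^ m * RInt h t 1 - / INR (S m) * (t ^ S m * h t))).
  { intros t.
    assert (Hq : is_derive (fun t => t ^ S m / INR (S m)) t (t ^ m)).
    { auto_derive; [exact I|]; change (pred (S m)) with m; field; auto. }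
    generalize (is_derive_mult _ _ t _ _ Hq (Hd t) Rmult_comm).
    unfold plus, mult; simpl AbsRing.sort; intros H.
    replace (_ - _) with (t ^ m * RInt h t 1 + t ^ S m / INR (S m) * - h t); [exact H|].
    unfold Rdiv; ring. }
  assert (H0 : is_RInt (fun t => t ^ m * RInt h t 1 - / INR (S m) * (t ^ S m * h t)) 0 1 0).
  { apply (is_RInt_antideriv _ _ _ _ _ HdP).
    - intros t; apply continuous_Rplus.
      + apply continuous_Rmult; [apply continuous_pow|].
        apply (ex_derive_continuous (fun t => RInt h t 1)); eexists; apply Hd.
      + apply (continuous_opp (fun t => / INR (S m) * (t ^ S m * h t))).
        apply continuous_Rmult; [apply continuous_const | apply Hc].
    - rewrite RInt_point; unfold zero; simpl; unfold Rdiv; ring. }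
  replace (_ / _) with (0 + / INR (S m) * RInt (fun s => s ^ S m * h s) 0 1)
    by (unfold Rdiv; ring).
  apply (is_RInt_ext (fun t => (t ^ m * RInt h t 1 - / INR (S m) * (t ^ S m * h t))
                               + / INR (S m) * (t ^ S m * h t))); [intros; simpl; ring|].
  apply is_RInt_Rplus; [exact H0|].
  apply (proj2 (linear_rel_RInt 0 1)), is_RInt_cont, Hc.
Qed.

(** Merges two variables into their sum [s = t + r], with a beta factor. Expanding [(s - t) ^ b]
    reduces the double integral to tail integrals in one variable, and [beta_sum] collects the
    coefficients. *)
Lemma is_RInt_convolution (g : R -> R) (a b : nat) :
  (forall t, continuous g t) -> (forall t, 1 <= t -> g t = 0) ->
  is_RInt (fun t => t ^ a * RInt (fun r => r ^ b * g (t + r)) 0 1) 0 1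
          (fR a * fR b / fR (a + b + 1) * RInt (fun s => s ^ (a + b + 1) * g s) 0 1).
Proof.
  intros Hg Hg1.
  assert (Hpg : forall n t, continuous (fun s => s ^ n * g s) t)
    by (intros n t; apply continuous_Rmult; auto using continuous_pow).
  apply (is_RInt_ext_open (fun t => sumR b (fun j =>
    Binomial.C b j * (-1) ^ j * (t ^ (a + j) * RInt (fun s => s ^ (b - j) * g s) t 1)))); [lra| |].
  - intros t Ht.
    assert (E : is_RInt (fun s => (s - t) ^ b * g s) t 1 (sumR b (fun j =>
       Binomial.C b j * (-1) ^ j * t ^ j * RInt (fun s => s ^ (b - j) * g s) t 1))).
    { apply (is_RInt_ext (fun s => sumR b (fun j =>
        Binomial.C b j * (-1) ^ j * t ^ j * (s ^ (b - j) * g s)))).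
      - intros s _; replace (s - t) with (- 1 * t + s) by ring.
        rewrite binomial_sumR, Rmult_comm, <- sumR_scal.
        apply sumR_ext; intros j _; rewrite Rpow_mult_distr; ring.
      - apply (sumR_rel (fun f v => is_RInt f t 1 v)); [apply linear_rel_RInt|].
        intros j _; apply (proj2 (linear_rel_RInt t 1)), is_RInt_cont, Hpg. }
    (* For [r] in [[0, 1]] the sum [s] runs over [[t, 1 + t]]; the part beyond 1 contributes nothing
       because [g] vanishes there. *)
    assert (E0 : is_RInt (fun s => (s - t) ^ b * g s) 1 (1 + t) 0).
    { apply (is_RInt_ext_open (fun _ => 0)); [lra| |].
      - intros s Hs; rewrite Hg1 by lra; ring.
      - generalize (is_RInt_const 1 (1 + t) 0); unfold scal; simpl; unfold mult; simpl.
        now rewrite Rmult_0_r. }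
    generalize (is_RInt_chain _ _ _ _ _ _ E E0); intros E1.
    rewrite (is_RInt_unique (fun r => r ^ b * g (t + r)) 0 1 (sumR b (fun j =>
       Binomial.C b j * (-1) ^ j * t ^ j * RInt (fun s => s ^ (b - j) * g s) t 1))).
    + rewrite <- sumR_scal; apply sumR_ext; intros j _; rewrite pow_add; ring.
    + rewrite Rplus_0_r in E1.
      apply (is_RInt_ext (fun r => scal 1 ((1 * r + t - t) ^ b * g (1 * r + t)))).
      * intros r _; unfold scal; simpl; unfold mult; simpl.
        replace (1 * r + t - t) with r by ring; replace (1 * r + t) with (t + r) by ring; ring.
      * apply (is_RInt_comp_lin (fun s => (s - t) ^ b * g s)).
        replace (1 * 0 + t) with t by ring; replace (1 * 1 + t) with (1 + t) by ring; exact E1.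
  - replace (_ * _) with (sumR b (fun j => Binomial.C b j * (-1) ^ j *
       (RInt (fun s => s ^ (a + b + 1) * g s) 0 1 / INR (a + j + 1)))).
    + apply (sumR_rel (fun f v => is_RInt f 0 1 v)); [apply linear_rel_RInt|].
      intros j Hj; apply (proj2 (linear_rel_RInt 0 1)).
      replace (RInt (fun s => s ^ (a + b + 1) * g s) 0 1)
        with (RInt (fun s => s ^ S (a + j) * (s ^ (b - j) * g s)) 0 1).
      * rewrite Nat.add_1_r; apply is_RInt_pow_tail, Hpg.
      * apply RInt_ext; intros s _; rewrite <- Rmult_assoc, <- pow_add; do 2 f_equal; lia.
    + rewrite (Rmult_comm (fR a)), (Nat.add_comm a b), <- beta_sum, Rmult_comm, <- sumR_scal.
      apply sumR_ext; intros j _; unfold Rdiv; ring.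
Qed.

(** A relational form of [iint] that also records integrability at every level, which makes it
    linear. Only [0 < t < 1] is constrained, so that faces of the cube can be ignored. *)
Fixpoint is_iint (n : nat) (f : (nat -> R) -> R) (v : R) : Prop :=
  match n with
  | O => f (fun _ => 0) = v
  | S n' => exists h : R -> R,
      (forall t, 0 < t < 1 -> is_iint n' (fun y => f (vcons t y)) (h t)) /\ is_RInt h 0 1 v
  end.

Lemma is_iint_unique (n : nat) (f : (nat -> R) -> R) (v : R) : is_iint n f v -> iint n f = v.
Proof.
  revert f v; induction n as [|n IH]; intros f v; simpl; [auto|].
  intros [h [Hh Hv]]; apply is_RInt_unique; revert Hv; apply is_RInt_ext_open; [lra|].
  intros t Ht; symmetry; apply IH, Hh, Ht.
Qed.

Lemma is_iint_ext (n : nat) (f g : (nat -> R) -> R) (v : R) :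
  (forall y, (forall l, (l < n)%nat -> 0 < y l < 1) -> f y = g y) ->
  is_iint n f v -> is_iint n g v.
Proof.
  revert f g v; induction n as [|n IH]; intros f g v H; simpl.
  - intros <-; symmetry; apply H; lia.
  - intros [h [Hh Hv]]; exists h; split; [|exact Hv].
    intros t Ht; apply (IH (fun y => f (vcons t y))); [|now apply Hh].
    intros y Hy; apply H; intros [|l] Hl; simpl; [exact Ht | apply Hy; lia].
Qed.

Lemma linear_rel_iint (n : nat) : linear_rel (is_iint n).
Proof.
  induction n as [|n IH]; [split; simpl; congruence|]; split.
  - intros f g u v [h [Hh Hu]] [k [Hk Hv]]; exists (fun t => h t + k t); split.
    + intros t Ht; apply IH; auto.
    + now apply is_RInt_Rplus.
  - intros x f u [h [Hh Hu]]; exists (fun t => x * h t); split.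
    + intros t Ht; apply (proj2 IH); auto.
    + now apply (proj2 (linear_rel_RInt 0 1)).
Qed.

Lemma powsum_vcons (n i : nat) (t : R) (y : nat -> R) :
  powsum (S n) i (vcons t y) = t ^ i + powsum n i y.
Proof.
  destruct n as [|n]; unfold powsum.
  - simpl; ring.
  - rewrite sumR_shift; reflexivity.
Qed.

(** Splitting off the first coordinate [t] replaces [g] by its translate by [t], which is why [g] is
    arbitrary in the induction. The convolution lemma then joins [t] to the sum of the other
    coordinates, and [Qc_succ] adds up the binomial terms. The dimension is [S n], so the exponent
    [n + 2 * c] is the dimension plus [2 * c] minus one. *)
Lemma is_iint_dirichlet (n c : nat) (g : R -> R) :
  (forall t, continuous g t) -> (forall t, 1 <= t -> g t = 0) ->
  is_iint (S n) (fun y => powsum (S n) 2 y ^ c * g (powsum (S n) 1 y))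
    (Qc c (INR (S n)) / fR (n + 2 * c) * RInt (fun r => r ^ (n + 2 * c) * g r) 0 1).
Proof.
  revert c g; induction n as [|n IH]; intros c g Hg Hg1.
  - exists (fun t => t ^ (2 * c) * g t); split.
    + intros t _; change (powsum 1 2 (vcons t (fun _ => 0)) ^ c
        * g (powsum 1 1 (vcons t (fun _ => 0))) = t ^ (2 * c) * g t).
      rewrite (powsum_vcons 0 1), (powsum_vcons 0 2); unfold powsum.
      rewrite !Rplus_0_r, pow_1, <- pow_mult; reflexivity.
    + change (INR 1) with 1; rewrite Qc_1; simpl (0 + _)%nat.
      unfold Rdiv; rewrite Rinv_r, Rmult_1_l by apply fR_neq0.
      apply is_RInt_cont; intros t; apply continuous_Rmult; auto using continuous_pow.
  - exists (fun t => sumR c (fun j => Binomial.C c j * Qc j (INR (S n)) / fR (n + 2 * j) *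
       (t ^ (2 * (c - j)) * RInt (fun r => r ^ (n + 2 * j) * g (t + r)) 0 1))); split.
    + intros t Ht.
      apply (is_iint_ext _ (fun y => sumR c (fun j => Binomial.C c j * t ^ (2 * (c - j)) *
         (powsum (S n) 2 y ^ j * g (t + powsum (S n) 1 y))))).
      * intros y _; rewrite !powsum_vcons, (Rplus_comm (t ^ 2)), binomial_sumR, pow_1.
        rewrite (Rmult_comm (sumR _ _)), <- sumR_scal.
        apply sumR_ext; intros j _; rewrite pow_mult; ring.
      * apply (sumR_rel (is_iint (S n))); [apply linear_rel_iint|]; intros j _.
        replace (_ * (_ * _)) with (Binomial.C c j * t ^ (2 * (c - j)) *
           (Qc j (INR (S n)) / fR (n + 2 * j) * RInt (fun r => r ^ (n + 2 * j) * g (t + r)) 0 1))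
          by (unfold Rdiv; ring).
        apply (proj2 (linear_rel_iint (S n))), (IH j (fun s => g (t + s))).
        -- intros s; apply (continuous_comp (fun s => t + s) g); [|apply Hg].
           apply continuous_Rplus; [apply continuous_const | apply continuous_id].
        -- intros s Hs; apply Hg1; lra.
    + rewrite (S_INR (S n)), Qc_succ; unfold Rdiv.
      rewrite Rmult_assoc, Rmult_comm, <- sumR_scal.
      apply (sumR_rel (fun f v => is_RInt f 0 1 v)); [apply linear_rel_RInt|]; intros j Hj.
      replace (S n + 2 * c)%nat with (2 * (c - j) + (n + 2 * j) + 1)%nat by lia.
      replace (_ * (_ * _)) with (Binomial.C c j * Qc j (INR (S n)) / fR (n + 2 * j) *
        (fR (2 * (c - j)) * fR (n + 2 * j) / fR (2 * (c - j) + (n + 2 * j) + 1) *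
         RInt (fun r => r ^ (2 * (c - j) + (n + 2 * j) + 1) * g r) 0 1)).
      * apply (proj2 (linear_rel_RInt 0 1)), is_RInt_convolution; auto.
      * field; split; apply fR_neq0.
Qed.

(** * The inner integral *)

Lemma continuous_sumR (n : nat) (f : nat -> R -> R) (t : R) :
  (forall i, continuous (f i) t) -> continuous (fun t => sumR n (fun i => f i t)) t.
Proof.
  intros Hf; induction n as [|n IH]; simpl; [apply Hf|].
  apply (continuous_Rplus (fun t => sumR n (fun i => f i t))); auto.
Qed.

(** The complete beta integral minus its part over [[0, u]], hence a polynomial in [u] and [v]. *)
Definition slice (b m : nat) (u v : R) : R :=
  fR b * fR m / fR (b + m + 1) * v ^ (b + m + 1) - beta_expand v b m u.

Lemma is_RInt_slice (b m : nat) (u v : R) :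
  is_RInt (fun t => (v - t) ^ b * t ^ m) u v (slice b m u v).
Proof.
  replace (slice b m u v) with
    (- beta_expand v b m u + fR b * fR m / fR (b + m + 1) * v ^ (b + m + 1))
    by apply Rplus_comm.
  apply (is_RInt_chain _ u 0 v); [apply is_RInt_flip, is_RInt_beta_expand | apply is_RInt_beta].
Qed.

Lemma slice_diag (b m : nat) (u : R) : slice b m u u = 0.
Proof.
  rewrite <- (is_RInt_unique _ _ _ _ (is_RInt_slice b m u u)).
  exact (RInt_point u _).
Qed.

(* [Rmax u v] makes the value [0] for [v <= u], which is what cutting off [F] outside the simplex
   amounts to, and keeps the function continuous in [v]. *)
Definition cut_slice (b m : nat) (u v : R) : R := slice b m u (Rmax u v).

Lemma cut_slice_above (b m : nat) (u v : R) : u <= v -> cut_slice b m u v = slice b m u v.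
Proof. intros H; unfold cut_slice; now rewrite Rmax_right. Qed.

Lemma cut_slice_below (b m : nat) (u v : R) : v <= u -> cut_slice b m u v = 0.
Proof. intros H; unfold cut_slice; rewrite Rmax_left by assumption; apply slice_diag. Qed.

Lemma continuous_cut_slice (b m : nat) (u v : R) : continuous (cut_slice b m u) v.
Proof.
  apply (continuous_comp (Rmax u) (slice b m u)).
  - apply (continuous_ext (fun v => / 2 * (u + v + Rabs (v + - u)))).
    + intros t; simpl; unfold Rmax; destruct (Rle_dec u t);
        [rewrite Rabs_right | rewrite Rabs_left]; lra.
    + apply continuous_Rmult; [apply continuous_const|].
      apply continuous_Rplus.
      * apply continuous_Rplus; [apply continuous_const | apply continuous_id].
      * apply (continuous_comp (fun t => t + - u) Rabs); [|apply continuous_Rabs].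
        apply continuous_Rplus; [apply continuous_id | apply continuous_const].
  - unfold slice, beta_expand; generalize (Rmax u v) as w; intros w.
    apply (continuous_minus (fun v => fR b * fR m / fR (b + m + 1) * v ^ (b + m + 1))).
    + apply continuous_Rmult; [apply continuous_const | apply continuous_pow].
    + apply (continuous_sumR b
        (fun j v => Binomial.C b j * (-1) ^ j * v ^ (b - j) * (u ^ (m + j + 1) / INR (m + j + 1)))).
      intros i; apply continuous_Rmult; [|apply continuous_const].
      apply continuous_Rmult; [apply continuous_const | apply continuous_pow].
Qed.

(** Covers both inner integrals: [u = 0] gives that of [F], and [u = 2 * xi / theta] that of
    [F_xi]. *)
Definition fiber (k s : nat) (a : nat -> R) (b c : nat -> nat) (u : R) (y : nat -> R) : R :=
  RInt (fun t => Ffun k s a b c (vcons (u + (1 - u) * t) y)) 0 1.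

Lemma innerF_fiber k s a b c y : innerF k s a b c y = fiber k s a b c 0 y.
Proof.
  unfold innerF, fiber; apply RInt_ext; intros t _; do 2 f_equal; ring.
Qed.

Lemma in_simplex_vcons (n : nat) (t : R) (y : nat -> R) :
  0 <= t -> (forall l, (l < n)%nat -> 0 <= y l) ->
  in_simplex (S n) (vcons t y) <-> t <= 1 - powsum n 1 y.
Proof.
  intros Ht Hy; unfold in_simplex; rewrite powsum_vcons, pow_1; split.
  - intros [_ H]; lra.
  - intros H; split; [|lra].
    intros [|l] Hl; simpl; [exact Ht | apply Hy; lia].
Qed.

Lemma powsum_nonneg (n i : nat) (y : nat -> R) :
  (forall l, (l < n)%nat -> 0 <= y l) -> 0 <= powsum n i y.
Proof.
  destruct n as [|n]; intros H; [apply Rle_refl|]; unfold powsum.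
  induction n as [|n IH]; simpl sumR.
  - apply pow_le, H; lia.
  - apply Rplus_le_le_0_compat; [|apply pow_le, H; lia].
    apply IH; intros l Hl; apply H; lia.
Qed.

Lemma is_RInt_zero (a b : R) : is_RInt (fun _ : R => 0) a b 0.
Proof.
  generalize (is_RInt_const a b 0); unfold scal; simpl; unfold mult; simpl.
  now rewrite Rmult_0_r.
Qed.

(** The affine substitution produces [/ (1 - u)], the simplex ends the range at
    [v = 1 - powsum n 1 y], and [(t ^ 2 + q) ^ c i] is expanded by the binomial theorem. *)
Lemma fiber_eq (n s : nat) (a : nat -> R) (b c : nat -> nat) (u : R) (y : nat -> R) :
  0 <= u < 1 -> (forall l, (l < n)%nat -> 0 < y l < 1) ->
  fiber (S n) s a b c u y =
  / (1 - u) * sumR s (fun i => a i * sumR (c i) (fun c1 =>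
    Binomial.C (c i) c1 * powsum n 2 y ^ c1 * cut_slice (b i) (2 * c i - 2 * c1) u (1 - powsum n 1 y))).
Proof.
  intros Hu Hy.
  assert (Hy0 : forall l, (l < n)%nat -> 0 <= y l) by (intros l Hl; apply Rlt_le, Hy, Hl).
  assert (Hsg := powsum_nonneg n 1 y Hy0).
  set (v := 1 - powsum n 1 y); set (q := powsum n 2 y).
  assert (HF : forall t, 0 <= t -> Ffun (S n) s a b c (vcons t y) =
     if Rle_dec t v then sumR s (fun i => a i * (v - t) ^ b i * (t ^ 2 + q) ^ c i) else 0).
  { intros t Ht; unfold Ffun.
    destruct (excluded_middle_informative _) as [H|H];
      rewrite (in_simplex_vcons n t y Ht Hy0) in H; fold v in H;
      destruct (Rle_dec t v); try contradiction; [|reflexivity].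
    apply sumR_ext; intros i _; rewrite !powsum_vcons, pow_1.
    unfold v, q; do 3 f_equal; ring. }
  assert (Hpos : forall t, 0 < t -> u < u + (1 - u) * t)
    by (intros t Ht; assert (0 < (1 - u) * t) by (apply Rmult_lt_0_compat; lra); lra).
  unfold fiber; apply is_RInt_unique.
  (* If [v <= u], the whole open segment lies outside the simplex and both sides are 0. *)
  destruct (Rle_lt_dec v u) as [Hv|Hv].
  - rewrite (sumR_ext _ _ (fun _ => 0)), sumR_0, Rmult_0_r.
    + apply (is_RInt_ext_open (fun _ => 0)); [lra| |apply is_RInt_zero].
      intros t Ht; specialize (Hpos t (proj1 Ht)).
      rewrite HF by lra; destruct (Rle_dec _ v); [lra | reflexivity].
    + intros i _; rewrite (sumR_ext _ _ (fun _ => 0)), sumR_0; [ring|].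
      intros c1 _; rewrite cut_slice_below by assumption; ring.
  - assert (Hp : is_RInt (fun t => sumR s (fun i => a i * (v - t) ^ b i * (t ^ 2 + q) ^ c i)) u v
      (sumR s (fun i => a i * sumR (c i) (fun c1 =>
        Binomial.C (c i) c1 * q ^ c1 * cut_slice (b i) (2 * c i - 2 * c1) u v)))).
    { apply (is_RInt_ext (fun t => sumR s (fun i => a i * sumR (c i) (fun c1 =>
        Binomial.C (c i) c1 * q ^ c1 * ((v - t) ^ b i * t ^ (2 * c i - 2 * c1)))))).
      - intros t _; apply sumR_ext; intros i _.
        rewrite (Rplus_comm (t ^ 2)), binomial_sumR, Rmult_assoc; f_equal.
        rewrite <- sumR_scal; apply sumR_ext; intros c1 _.
        rewrite <- pow_mult, Nat.mul_sub_distr_l; ring.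
      - apply (sumR_rel (fun f w => is_RInt f u v w)); [apply linear_rel_RInt|]; intros i _.
        apply (proj2 (linear_rel_RInt u v)).
        apply (sumR_rel (fun f w => is_RInt f u v w)); [apply linear_rel_RInt|]; intros c1 _.
        apply (proj2 (linear_rel_RInt u v)).
        rewrite cut_slice_above by lra; apply is_RInt_slice. }
    set (I := sumR s _) in Hp |- *.
    set (p := fun t => sumR s _) in Hp.
    (* The parameter at which the segment leaves the simplex; [w <= 1] because [v <= 1]. *)
    set (w := (v - u) / (1 - u)).
    assert (Hw : (1 - u) * w = v - u) by (unfold w; field; lra).
    assert (Hw0 : 0 < w) by (apply Rdiv_lt_0_compat; lra).
    assert (Hw1 : w <= 1).
    { apply (Rmult_le_reg_l (1 - u)); [lra|]; rewrite Hw; unfold v; lra. }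
    rewrite <- (Rplus_0_r (_ * I)).
    apply (is_RInt_chain _ 0 w 1).
    + apply (is_RInt_ext_open (fun t => / (1 - u) * ((1 - u) * p ((1 - u) * t + u)))); [lra| |].
      * intros t Ht; assert (Ht0 := Hpos t (proj1 Ht)).
        assert ((1 - u) * t < (1 - u) * w) by (apply Rmult_lt_compat_l; lra).
        rewrite HF by lra; destruct (Rle_dec _ v) as [_|]; [|lra].
        fold (p (u + (1 - u) * t)); rewrite (Rplus_comm u); field; lra.
      * apply (proj2 (linear_rel_RInt 0 w)), (is_RInt_comp_lin p (1 - u) u).
        rewrite Hw; replace ((1 - u) * 0 + u) with u by ring.
        replace (v - u + u) with v by ring; exact Hp.
    + apply (is_RInt_ext_open (fun _ => 0)); [lra| |apply is_RInt_zero].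
      intros t Ht.
      assert ((1 - u) * w < (1 - u) * t) by (apply Rmult_lt_compat_l; lra).
      rewrite HF by lra; destruct (Rle_dec _ v); [lra | reflexivity].
Qed.

(** The radial integral left by the Dirichlet formula, [r] being the sum of the last [n + 1]
    coordinates. The lower limits [(u, v)] will be [(0, 0)] for [J_k], [(u, 0)] for [L_k] and
    [(u, u)] for [M_k]. *)
Definition pair_integral (n : nat) (b c : nat -> nat) (u v : R) (i j c1 c2 : nat) : R :=
  RInt (fun r => r ^ (n + 2 * (c1 + c2)) * (cut_slice (b i) (2 * c i - 2 * c1) u (1 - r)
                                          * cut_slice (b j) (2 * c j - 2 * c2) v (1 - r))) 0 1.

(** The product of the two expansions of [fiber_eq] is integrated term by term with
    [is_iint_dirichlet]. Here [k = n + 2], so the [n + 1] remaining variables give [Q_c(k-1)]. *)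
Lemma is_iint_fiber_mult (n s : nat) (a : nat -> R) (b c : nat -> nat) (u v : R) :
  0 <= u < 1 -> 0 <= v < 1 ->
  is_iint (S n) (fun y => fiber (S (S n)) s a b c u y * fiber (S (S n)) s a b c v y)
    (/ (1 - u) * / (1 - v) * outer (S (S n)) s a c (fun i j c1 c2 =>
       pair_integral n b c u v i j c1 c2 / DD (S (S n)) c1 c2)).
Proof.
  intros Hu Hv.
  apply (is_iint_ext _ (fun y => / (1 - u) * / (1 - v) * sumR s (fun i => sumR s (fun j =>
    a i * a j * sumR (c i) (fun c1 => sumR (c j) (fun c2 =>
    Binomial.C (c i) c1 * Binomial.C (c j) c2 * (powsum (S n) 2 y ^ (c1 + c2) *
      (cut_slice (b i) (2 * c i - 2 * c1) u (1 - powsum (S n) 1 y) *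
       cut_slice (b j) (2 * c j - 2 * c2) v (1 - powsum (S n) 1 y))))))))).
  - intros y Hy; rewrite !fiber_eq by assumption.
    rewrite (Rmult_assoc (/ (1 - u)) (sumR _ _)), (Rmult_comm (sumR _ _) (_ * _)).
    rewrite !(Rmult_assoc (/ (1 - _))); do 2 f_equal.
    rewrite (Rmult_comm (sumR _ _)), sumR_mult.
    apply sumR_ext; intros i _; apply sumR_ext; intros j _.
    match goal with |- _ = ?x * ?X * (?y * ?Y) => replace (x * X * (y * Y)) with (x * y * (X * Y)) by ring end.
    rewrite sumR_mult; f_equal; apply sumR_ext; intros c1 _; apply sumR_ext; intros c2 _.
    rewrite pow_add; ring.
  - apply (proj2 (linear_rel_iint (S n))); unfold outer.
    apply (sumR_rel (is_iint (S n))); [apply linear_rel_iint|]; intros i _.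
    apply (sumR_rel (is_iint (S n))); [apply linear_rel_iint|]; intros j _.
    apply (proj2 (linear_rel_iint (S n))).
    apply (sumR_rel (is_iint (S n))); [apply linear_rel_iint|]; intros c1 _.
    apply (sumR_rel (is_iint (S n))); [apply linear_rel_iint|]; intros c2 _.
    rewrite (Rmult_assoc (_ * _)).
    apply (proj2 (linear_rel_iint (S n))).
    replace (INR (S (S n)) - 1) with (INR (S n)) by (rewrite (S_INR (S n)); ring).
    unfold DD, pair_integral; replace (S (S n) + 2 * c1 + 2 * c2 - 2)%nat with (n + 2 * (c1 + c2))%nat by lia.
    rewrite <- (Rmult_comm (RInt _ _ _ / _)).
    match goal with |- is_iint _ _ (?I / ?d * ?q) => replace (I / d * q) with (q / d * I) by (unfold Rdiv; ring) end.
    apply (is_iint_dirichlet n (c1 + c2) (fun r => cut_slice (b i) (2 * c i - 2 * c1) u (1 - r)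
                                          * cut_slice (b j) (2 * c j - 2 * c2) v (1 - r))).
    + assert (H : forall p m x t, continuous (fun r => cut_slice p m x (1 - r)) t).
      { intros p m x t; apply (continuous_comp (fun r => 1 - r) (cut_slice p m x));
          [|apply continuous_cut_slice].
        apply (continuous_minus (fun _ => 1) (fun r => r)); [apply continuous_const | apply continuous_id]. }
      intros t; apply continuous_Rmult; apply H.
    (* For [t >= 1] the argument [1 - t] is at most 0, hence not above the lower limit of the
       slice. *)
    + intros t Ht; rewrite cut_slice_below by lra; ring.
Qed.

(** * Logarithmic cancellation, [lambda] and [mu] *)

Lemma rising_INR (m j : nat) : rising (INR (S m)) j = fR (m + j) / fR m.
Proof.
  induction j as [|j IH]; simpl rising.
  - rewrite Nat.add_0_r; field; apply fR_neq0.
  - rewrite IH, Nat.add_succ_r, fR_S, <- plus_INR, <- plus_Sn_m; field; apply fR_neq0.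
Qed.

Lemma geometric_remainder (x : R) (J : nat) : x <> 1 ->
  / (1 - x) = sumR J (fun j => x ^ j) + x ^ S J / (1 - x).
Proof.
  intros Hx; induction J as [|J IH].
  - simpl; field; lra.
  - rewrite sumR_succ, IH; simpl pow; field; lra.
Qed.

(** The range [u < 2] contains a neighbourhood of [[0, 1]], as continuity at the endpoints
    requires. *)
Lemma kernel_pos (z u : R) : 0 < z <= / 2 -> u < 2 -> 0 < 1 - z * u.
Proof. intros Hz Hu; nra. Qed.

Lemma continuous_kernel (z u : R) (phi : R -> R) : 0 < z <= / 2 -> u < 2 ->
  continuous phi u -> continuous (fun u => - z * phi u / (1 - z * u)) u.
Proof.
  intros Hz Hu Hphi; assert (H := kernel_pos z u Hz Hu).
  apply (continuous_Rmult (fun u => - z * phi u)).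
  - apply continuous_Rmult; [apply continuous_const | exact Hphi].
  - apply (ex_derive_continuous (fun u => / (1 - z * u))); auto_derive; lra.
Qed.

Lemma ex_RInt_kernel (z a b : R) (phi : R -> R) : 0 < z <= / 2 -> a < 2 -> b < 2 ->
  (forall u, continuous phi u) -> ex_RInt (fun u => - z * phi u / (1 - z * u)) a b.
Proof.
  intros Hz Ha Hb Hphi; apply (ex_RInt_continuous (V := R_CompleteNormedModule)).
  intros u Hu; apply continuous_kernel; auto.
  apply Rle_lt_trans with (1 := proj2 Hu), Rmax_lub_lt; assumption.
Qed.

(** Finite geometric expansion of the kernel: each power of [z * u] yields a complete beta integral,
    and the remainder is at most [2 * z ^ S J]. *)
Lemma is_series_beta (z : R) (m n : nat) : 0 < z <= / 2 ->
  is_series (fun j => z ^ j * (fR n * fR (m + j) / fR (n + (m + j) + 1)))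
    (RInt (fun u => (1 - u) ^ n * u ^ m / (1 - z * u)) 0 1).
Proof.
  intros Hz.
  set (I := RInt _ 0 1).
  set (rem := fun J u => z ^ S J * ((1 - u) ^ n * u ^ (m + S J) / (1 - z * u))).
  assert (Hc : forall p q u, u < 2 -> continuous (fun u => (1 - u) ^ p * u ^ q / (1 - z * u)) u).
  { intros p q u Hu; assert (H := kernel_pos z u Hz Hu).
    apply (ex_derive_continuous (fun u => (1 - u) ^ p * u ^ q / (1 - z * u))); auto_derive; lra. }
  assert (Hi : forall p q, is_RInt (fun u => (1 - u) ^ p * u ^ q / (1 - z * u)) 0 1
     (RInt (fun u => (1 - u) ^ p * u ^ q / (1 - z * u)) 0 1)).
  { intros p q; apply (RInt_correct (V := R_CompleteNormedModule)).
    apply (ex_RInt_continuous (V := R_CompleteNormedModule)); intros u Hu.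
    rewrite Rmin_left, Rmax_right in Hu by lra; apply Hc; lra. }
  assert (Hr : forall J, is_RInt (rem J) 0 1 (RInt (rem J) 0 1)).
  { intros J; apply (RInt_correct (V := R_CompleteNormedModule)).
    eexists; apply (proj2 (linear_rel_RInt 0 1)), Hi. }
  assert (HI : forall J, I = sumR J (fun j => z ^ j * (fR n * fR (m + j) / fR (n + (m + j) + 1)))
                           + RInt (rem J) 0 1).
  { intros J; apply is_RInt_unique.
    apply (is_RInt_ext_open (fun u => sumR J (fun j => z ^ j * ((1 - u) ^ n * u ^ (m + j))) + rem J u)).
    - lra.
    - intros u Hu; assert (H := kernel_pos z u Hz ltac:(lra)); unfold rem.
      unfold Rdiv at 2; rewrite (geometric_remainder (z * u) J) by lra.
      rewrite Rmult_plus_distr_l, <- sumR_scal; f_equal.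
      + apply sumR_ext; intros j _; rewrite pow_add, Rpow_mult_distr; ring.
      + rewrite pow_add, Rpow_mult_distr; unfold Rdiv; ring.
    - apply is_RInt_Rplus; [|apply Hr].
      apply (sumR_rel (fun f v => is_RInt f 0 1 v)); [apply linear_rel_RInt|]; intros j _.
      apply (proj2 (linear_rel_RInt 0 1)).
      generalize (is_RInt_beta 1 n (m + j)); now rewrite pow1, Rmult_1_r. }
  assert (Hbound : forall J, Rabs (RInt (rem J) 0 1) <= 2 * z ^ S J).
  { intros J; replace (2 * z ^ S J) with ((1 - 0) * (2 * z ^ S J)) by ring.
    apply abs_RInt_le_const; [lra | eexists; apply Hr|].
    intros u Hu; assert (H := kernel_pos z u Hz ltac:(lra)).
    (* The factor 2 in the bound is the inverse of this lower bound for the denominator. *)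
    assert (Hzu : / 2 <= 1 - z * u) by nra.
    assert (HzJ : 0 <= z ^ S J) by (apply pow_le; lra).
    assert (H1 : 0 <= (1 - u) ^ n <= 1).
    { split; [apply pow_le; lra | rewrite <- (pow1 n) at 2; apply pow_incr; lra]. }
    assert (H2 : 0 <= u ^ (m + S J) <= 1).
    { split; [apply pow_le; lra | rewrite <- (pow1 (m + S J)); apply pow_incr; lra]. }
    assert (H3 : 0 < / (1 - z * u) <= 2).
    { split; [now apply Rinv_0_lt_compat | rewrite <- (Rinv_inv 2); apply Rinv_le_contravar; lra]. }
    assert (H4 : 0 <= (1 - u) ^ n * u ^ (m + S J) <= 1).
    { split; [apply Rmult_le_pos; lra | rewrite <- (Rmult_1_l 1) at 2; apply Rmult_le_compat; lra]. }
    unfold rem, Rdiv; rewrite Rabs_right.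
    - rewrite (Rmult_comm 2); apply Rmult_le_compat_l; [exact HzJ|].
      rewrite <- (Rmult_1_l 2); apply Rmult_le_compat; lra.
    - apply Rle_ge, Rmult_le_pos; [exact HzJ | apply Rmult_le_pos; lra]. }
  assert (Hrem : is_lim_seq (fun J => RInt (rem J) 0 1) 0).
  { apply (is_lim_seq_abs_0 (fun J => RInt (rem J) 0 1)).
    apply (is_lim_seq_le_le (fun _ => 0) _ (fun J => 2 * z ^ S J)).
    - intros J; split; [apply Rabs_pos | apply Hbound].
    - apply is_lim_seq_const.
    - replace (Finite 0) with (Rbar_mult 2 0) by (simpl; f_equal; ring).
      apply is_lim_seq_scal_l, (is_lim_seq_incr_1 (fun J => z ^ J)), is_lim_seq_geom.
      rewrite Rabs_right; lra. }
  assert (Hlim : is_lim_seq (fun J => I - RInt (rem J) 0 1) (I - 0)).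
  { apply is_lim_seq_minus'; [apply is_lim_seq_const | exact Hrem]. }
  rewrite Rminus_0_r in Hlim; revert Hlim; apply is_lim_seq_ext.
  intros J; rewrite (HI J) at 1.
  transitivity (sumR J (fun j => z ^ j * (fR n * fR (m + j) / fR (n + (m + j) + 1)))); [ring|].
  induction J as [|J IH]; [now rewrite sum_O | now rewrite sumR_succ, sum_Sn, IH].
Qed.

(** Euler's integral for the hypergeometric function, compared term by term: the rising factorial of
    1 cancels the factorial in the series, and the prefactor of [mu] is a beta value. *)
Lemma mu_RInt (theta : R) (m n : nat) : 0 < theta <= 1 ->
  mu theta (S m) n
  = RInt (fun u => theta / 2 * ((1 - u) ^ n * u ^ m / (1 - theta / 2 * u))) 0 1.
Proof.
  intros Ht; set (z := theta / 2).
  assert (Hz : 0 < z <= / 2) by (unfold z; lra).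
  assert (HI : ex_RInt (fun u => (1 - u) ^ n * u ^ m / (1 - z * u)) 0 1).
  { apply (ex_RInt_continuous (V := R_CompleteNormedModule)); intros u Hu.
    rewrite Rmin_left, Rmax_right in Hu by lra.
    assert (H := kernel_pos z u Hz ltac:(lra)).
    apply (ex_derive_continuous (fun u => (1 - u) ^ n * u ^ m / (1 - z * u))); auto_derive; lra. }
  rewrite (RInt_scal (V := R_CompleteNormedModule) (fun u => (1 - u) ^ n * u ^ m / (1 - z * u)))
    by exact HI.
  rewrite <- (is_series_unique _ _ (is_series_beta z m n Hz)).
  unfold mu, hyp2F1; fold z; change (scal z ?x) with (z * x).
  unfold Rdiv at 1; rewrite Rmult_assoc; f_equal.
  rewrite Rmult_comm, <- Series_scal_l; apply Series_ext; intros j.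
  rewrite <- plus_INR, <- S_INR, !rising_INR.
  change 1 with (INR 1) at 1; rewrite rising_INR.
  unfold Binomial.C; rewrite Nat.add_sub; fold (fR (S m + n)) (fR n) (fR (S m)) (fR j).
  simpl (0 + j)%nat.
  replace (n + (m + j) + 1)%nat with (S m + n + j)%nat by lia.
  replace (fR (S m)) with (INR (S m) * fR m) by (symmetry; apply fR_S).
  change (fR 0) with 1; simpl (S m + n)%nat.
  field; repeat split; try apply fR_neq0; apply not_0_INR; lia.
Qed.

(* With [psi u = E 0 - E u] and [u = xi / z], the counterterm cancels the pole at [xi = 0] of the
   integral of [z / (xi (1 - xi)) E (xi / z)]; what is left in the limit is [V]. *)
Definition defect (z : R) (psi : R -> R) (V : R) : Prop :=
  exists phi : R -> R,
    (forall u, continuous phi u) /\ (forall u, 0 < u < 1 -> psi u = u * phi u) /\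
    is_RInt (fun u => - z * phi u / (1 - z * u)) 0 1 V.

Lemma linear_rel_defect (z : R) : linear_rel (defect z).
Proof.
  split.
  - intros f g U V [p [Hp [Hf HU]]] [q [Hq [Hg HV]]]; exists (fun u => p u + q u).
    split; [intros u; apply continuous_Rplus; auto|].
    split; [intros u Hu; rewrite Hf, Hg by assumption; ring|].
    apply (is_RInt_ext (fun u => - z * p u / (1 - z * u) + - z * q u / (1 - z * u))).
    + intros u _; simpl; unfold Rdiv; ring.
    + now apply is_RInt_Rplus.
  - intros x f U [p [Hp [Hf HU]]]; exists (fun u => x * p u).
    split; [intros u; apply continuous_Rmult; auto using continuous_const|].
    split; [intros u Hu; rewrite Hf by assumption; ring|].
    apply (is_RInt_ext (fun u => x * (- z * p u / (1 - z * u)))).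
    + intros u _; simpl; unfold Rdiv; ring.
    + now apply (proj2 (linear_rel_RInt 0 1)).
Qed.

Lemma defect_ext (z : R) (f g : R -> R) (V : R) :
  (forall u, 0 < u < 1 -> f u = g u) -> defect z f V -> defect z g V.
Proof.
  intros H [p [Hp [Hf HV]]]; exists p; repeat split; auto.
  intros u Hu; rewrite <- H; auto.
Qed.

(** One power of [u] is divided out; the minus sign is that of the kernel in [defect]. *)
Lemma defect_mu (theta : R) (m n : nat) : 0 < theta <= 1 ->
  defect (theta / 2) (fun u => u ^ S m * (1 - u) ^ n) (- mu theta (S m) n).
Proof.
  intros Ht; exists (fun u => (1 - u) ^ n * u ^ m); split; [|split].
  - intros u; apply (ex_derive_continuous (fun u => (1 - u) ^ n * u ^ m)); auto_derive; exact I.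
  - intros u _; simpl; ring.
  - set (z := theta / 2); assert (Hz : 0 < z <= / 2) by (unfold z; lra).
    rewrite mu_RInt by assumption; fold z.
    replace (- RInt _ 0 1) with (RInt (fun u => - z * ((1 - u) ^ n * u ^ m) / (1 - z * u)) 0 1).
    + apply (RInt_correct (V := R_CompleteNormedModule)), ex_RInt_kernel; try lra.
      intros u; apply (ex_derive_continuous (fun u => (1 - u) ^ n * u ^ m)); auto_derive; exact I.
    + apply is_RInt_unique.
      apply (is_RInt_ext (fun u => - (z * ((1 - u) ^ n * u ^ m / (1 - z * u))))).
      { intros u _; simpl; unfold Rdiv; ring. }
      apply (is_RInt_opp (V := R_CompleteNormedModule)), (RInt_correct (V := R_CompleteNormedModule)).
      apply (ex_RInt_ext (fun u => - (- z * ((1 - u) ^ n * u ^ m) / (1 - z * u)))).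
      { intros u _; simpl; unfold Rdiv; ring. }
      apply (ex_RInt_opp (V := R_CompleteNormedModule)), ex_RInt_kernel; try lra.
      intros u; apply (ex_derive_continuous (fun u => (1 - u) ^ n * u ^ m)); auto_derive; exact I.
Qed.

(** A geometric sum in [1 - u] divides out [u]. The three pieces of the integrand then yield the
    harmonic number, the logarithm and the hypergeometric term of [lam]. *)
Lemma defect_lam (theta : R) (m : nat) : 0 < theta <= 1 ->
  defect (theta / 2) (fun u => 1 - (1 - u) ^ S m) (lam theta (S m)).
Proof.
  intros Ht; set (z := theta / 2); assert (Hz : 0 < z <= / 2) by (unfold z; lra).
  assert (Hgeo : forall u, 1 - (1 - u) ^ S m = u * sumR m (fun i => (1 - u) ^ i)).
  { intros u; clear; induction m as [|m IH]; [simpl; ring|].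
    rewrite sumR_succ, Rmult_plus_distr_l, <- IH; simpl; ring. }
  exists (fun u => sumR m (fun i => (1 - u) ^ i)); split; [|split].
  - intros u; apply (continuous_sumR m (fun i u => (1 - u) ^ i)); intros i.
    apply (ex_derive_continuous (fun u => (1 - u) ^ i)); auto_derive; exact I.
  - intros u _; apply Hgeo.
  - (* [phi / (1 - z u) = phi + z (1 - (1 - u)^(m+1)) / (1 - z u)] *)
    apply (is_RInt_ext_open (fun u => - z * sumR m (fun i => (1 - u) ^ i)
       + (z * (- z / (1 - z * u)) + z * (z * ((1 - u) ^ S m * u ^ 0 / (1 - z * u)))))); [lra| |].
    + intros u Hu; assert (H := kernel_pos z u Hz ltac:(lra)).
      replace ((1 - u) ^ S m) with (1 - u * sumR m (fun i => (1 - u) ^ i)) by (rewrite <- Hgeo; ring).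
      simpl (u ^ 0); field; lra.
    + replace (lam theta (S m)) with
        (- z * harm (S m) + (z * ln (1 - z) + z * mu theta 1 (S m))).
      * apply is_RInt_Rplus; [|apply is_RInt_Rplus].
        -- apply (proj2 (linear_rel_RInt 0 1)).
           apply (sumR_rel (fun f v => is_RInt f 0 1 v)); [apply linear_rel_RInt|]; intros i _.
           generalize (is_RInt_beta 1 i 0); rewrite pow1, Rmult_1_r, Nat.add_0_r, Nat.add_1_r, fR_S.
           change (fR 0) with 1.
           replace (fR i * 1 / _) with (/ INR (S i))
             by (field; split; [apply fR_neq0 | apply not_0_INR; lia]).
           apply is_RInt_ext; intros u _; simpl; ring.
        -- apply (proj2 (linear_rel_RInt 0 1)).
           replace (ln (1 - z)) with (minus (ln (1 - z * 1)) (ln (1 - z * 0))).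
           2:{ unfold minus, plus, opp; simpl; rewrite Rmult_0_r, Rmult_1_r, Rminus_0_r, ln_1; ring. }
           apply (is_RInt_derive (fun u => ln (1 - z * u)));
             intros u Hu; rewrite Rmin_left, Rmax_right in Hu by lra;
             assert (H := kernel_pos z u Hz ltac:(lra)).
           ++ auto_derive; [lra | field; lra].
           ++ apply (ex_derive_continuous (fun u => - z / (1 - z * u))); auto_derive; lra.
        -- apply (proj2 (linear_rel_RInt 0 1)).
           rewrite mu_RInt by assumption; fold z.
           apply (RInt_correct (V := R_CompleteNormedModule)).
           apply (ex_RInt_ext (fun u => - (- z * ((1 - u) ^ S m * u ^ 0) / (1 - z * u)))).
           { intros u _; simpl; unfold Rdiv; ring. }
           apply (ex_RInt_opp (V := R_CompleteNormedModule)), ex_RInt_kernel; try lra.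
           intros u; apply (ex_derive_continuous (fun u => (1 - u) ^ S m * u ^ 0)); auto_derive; exact I.
      * unfold lam, mu; fold z.
        replace (INR 1 + INR (S m) + 1) with (INR (S m) + 2) by (change (INR 1) with 1; ring).
        change (INR 1) with 1; unfold Binomial.C; rewrite Nat.add_sub.
        change (1 + S m)%nat with (S (S m)).
        fold (fR (S (S m))) (fR (S m)) (fR 1); rewrite (fR_S (S m)), (S_INR (S m)).
        change (fR 1) with 1; field; split; [|apply fR_neq0].
        rewrite <- S_INR; apply not_0_INR; lia.
Qed.

(** By partial fractions [ln (xi / (1 - xi))] is an antiderivative; its value at the upper limit [z]
    accounts for the constant [/ z - 1] in the counterterm. *)
Lemma is_RInt_log (z eta : R) : 0 < eta < z -> z < 1 ->
  is_RInt (fun xi => / (xi * (1 - xi))) eta z (ln ((1 - eta) / (eta * (/ z - 1)))).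
Proof.
  intros He Hz.
  replace (ln _) with (minus (ln (z / (1 - z))) (ln (eta / (1 - eta)))).
  - apply (is_RInt_derive (fun xi => ln (xi / (1 - xi))));
      intros xi Hxi; rewrite Rmin_left, Rmax_right in Hxi by lra.
    + auto_derive.
      * split; [lra|split; [|exact I]]; apply Rdiv_lt_0_compat; lra.
      * field; lra.
    + assert (xi * (1 - xi) <> 0) by (apply Rmult_integral_contrapositive; lra).
      apply (ex_derive_continuous (fun xi => / (xi * (1 - xi)))); auto_derive; auto.
  - assert (H : 0 < / z - 1).
    { enough (1 < / z) by lra; rewrite <- Rinv_1; apply Rinv_lt_contravar; lra. }
    unfold minus, plus, opp; simpl.
    rewrite <- ln_Rinv by (apply Rdiv_lt_0_compat; lra).
    rewrite <- ln_mult; [f_equal; field; repeat split; lra| |apply Rinv_0_lt_compat];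
      apply Rdiv_lt_0_compat; lra.
Qed.

(** Writing [E u = E0 - u * phi u] splits [f] into a multiple of [/ (xi * (1 - xi))], whose integral
    is exactly the counterterm, and a part without pole. With [u = xi / z] the latter becomes the
    integral of [h] over [[eta / z, 1]]. *)
Lemma filterlim_defect (z E0 V : R) (E psi f : R -> R) : 0 < z <= / 2 ->
  defect z psi V -> (forall u, 0 < u < 1 -> E0 - E u = psi u) ->
  (forall xi, 0 < xi < z -> f xi = z / (xi * (1 - xi)) * E (xi / z)) ->
  filterlim (fun eta => RInt f eta z - z * ln ((1 - eta) / (eta * (/ z - 1))) * E0)
    (at_right 0) (locally V).
Proof.
  intros Hz [phi [Hphi [Hpsi HV]]] HE Hf.
  set (h := fun u => - z * phi u / (1 - z * u)) in HV.
  assert (Hh : forall x, x < 2 -> is_RInt h x 1 (RInt h x 1)).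
  { intros x Hx; apply (RInt_correct (V := R_CompleteNormedModule)), ex_RInt_kernel; auto; lra. }
  apply (filterlim_ext_loc (fun eta => RInt h (eta / z) 1)).
  - exists (mkposreal z (proj1 Hz)); intros eta Hb He.
    assert (Heta : eta < z).
    { unfold ball in Hb; simpl in Hb; unfold AbsRing_ball, abs, minus, plus, opp in Hb; simpl in Hb.
      apply Rabs_def2 in Hb; lra. }
    assert (Hez : eta / z < 1) by (apply (Rmult_lt_reg_r z); [lra|]; field_simplify; lra).
    enough (H : is_RInt f eta z (z * E0 * ln ((1 - eta) / (eta * (/ z - 1))) + RInt h (eta / z) 1)).
    { rewrite (is_RInt_unique _ _ _ _ H).
      enough (Hring : forall x y w : R, w = x * E0 * y + w - x * y * E0) by apply Hring.
      intros; ring. }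
    apply (is_RInt_ext_open (fun xi => z * E0 * / (xi * (1 - xi)) + / z * h (/ z * xi + 0))); [lra| |].
    + intros xi Hxi; rewrite Hf by lra.
      assert (Hu : 0 < xi / z < 1).
      { split; [apply Rdiv_lt_0_compat; lra|].
        apply (Rmult_lt_reg_r z); [lra|]; field_simplify; lra. }
      assert (HEu : E (xi / z) = E0 - xi / z * phi (xi / z)) by (rewrite <- Hpsi, <- HE by assumption; ring).
      rewrite HEu; unfold h.
      replace (/ z * xi + 0) with (xi / z) by (field; lra).
      replace (1 - z * (xi / z)) with (1 - xi) by (field; lra).
      field; lra.
    + apply is_RInt_Rplus.
      * apply (proj2 (linear_rel_RInt eta z)), is_RInt_log; lra.
      * apply (is_RInt_comp_lin h).
        replace (/ z * eta + 0) with (eta / z) by (field; lra).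
        replace (/ z * z + 0) with 1 by (field; lra).
        apply Hh; lra.
  - rewrite <- (is_RInt_unique _ _ _ _ HV).
    (* The one-sided limit follows from two-sided continuity at 0 of the integral in its lower
       limit. *)
    apply (filterlim_filter_le_1 (F := locally 0) (G := at_right 0) (fun eta => RInt h (eta / z) 1));
      [apply filter_le_within|].
    assert (Hc : continuous (fun x => RInt h x 1) (0 / z)).
    { replace (0 / z) with 0 by (unfold Rdiv; ring).
      apply (continuous_RInt_2 h 0 1 (fun x => RInt h x 1)).
      exists (mkposreal 1 Rlt_0_1); intros x Hx; apply Hh.
      unfold ball in Hx; simpl in Hx; unfold AbsRing_ball, abs, minus, plus, opp in Hx; simpl in Hx.
      apply Rabs_def2 in Hx; lra. }
    replace (RInt h 0 1) with (RInt h (0 / z) 1) by (f_equal; unfold Rdiv; ring).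
    refine (continuous_comp (fun eta => eta / z) (fun x => RInt h x 1) 0 _ Hc).
    apply (ex_derive_continuous (fun eta => eta / z)); auto_derive; exact I.
Qed.

(** * Evaluation of the radial integrals *)

(** A slice is sorted by powers of [v]: the top coefficient [slice_lead] is a beta value free of
    [u], while every [slice_coef] carries a positive power of [u]. *)
Definition slice_lead (b m : nat) : R := fR b * fR m / fR (b + m + 1).

Definition slice_coef (b m j : nat) (u : R) : R :=
  Binomial.C b j * (-1) ^ j * (u ^ (m + j + 1) / INR (m + j + 1)).

Lemma slice_expand (b m : nat) (u v : R) :
  slice b m u v = slice_lead b m * v ^ (b + m + 1)
                  - sumR b (fun j => slice_coef b m j u * v ^ (b - j)).
Proof.
  unfold slice, beta_expand; f_equal; apply sumR_ext; intros j _.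
  unfold slice_coef; ring.
Qed.

(** The top term of the second slice against the lower terms of the first, integrated with weight
    [r ^ p] over [[0, w]]. *)
Definition cross_slice (p b1 m1 b2 m2 : nat) (u w : R) : R :=
  slice_lead b2 m2 * sumR b1 (fun j => slice_coef b1 m1 j u
                                       * beta_expand 1 (b1 - j + (b2 + m2 + 1)) p w).

(** The product of two slices has four parts: top by top, two mixed, lower by lower. They lead to
    [term1], to two copies of [term2] and to [term3]. *)
Definition pair_value (p b1 m1 b2 m2 : nat) (u v w : R) : R :=
  slice_lead b1 m1 * slice_lead b2 m2 * beta_expand 1 (b1 + m1 + 1 + (b2 + m2 + 1)) p w
  + (- 1 * cross_slice p b1 m1 b2 m2 u w + (- 1 * cross_slice p b2 m2 b1 m1 v w
  + sumR b1 (fun j => sumR b2 (fun l =>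
      slice_coef b1 m1 j u * slice_coef b2 m2 l v * beta_expand 1 (b1 - j + (b2 - l)) p w)))).

Lemma is_RInt_slice_pair (p b1 m1 b2 m2 : nat) (u v w : R) :
  is_RInt (fun r => r ^ p * (slice b1 m1 u (1 - r) * slice b2 m2 v (1 - r))) 0 w
    (pair_value p b1 m1 b2 m2 u v w).
Proof.
  assert (Hlin := linear_rel_RInt 0 w); assert (Hscal := proj2 Hlin).
  set (mono := fun d r => (1 - r) ^ d * r ^ p).
  assert (Hmono : forall d, is_RInt (mono d) 0 w (beta_expand 1 d p w))
    by (intros d; apply is_RInt_beta_expand).
  set (cross := fun b1 m1 b2 m2 u r => slice_lead b2 m2 * sumR b1 (fun j =>
    slice_coef b1 m1 j u * mono (b1 - j + (b2 + m2 + 1))%nat r)).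
  assert (Hcross : forall b1 m1 b2 m2 u,
    is_RInt (cross b1 m1 b2 m2 u) 0 w (cross_slice p b1 m1 b2 m2 u w)).
  { intros; apply Hscal, (sumR_rel (fun f x => is_RInt f 0 w x)); [exact Hlin|]; intros j _.
    apply Hscal, Hmono. }
  apply (is_RInt_ext_all (fun r =>
    slice_lead b1 m1 * slice_lead b2 m2 * mono (b1 + m1 + 1 + (b2 + m2 + 1))%nat r
    + (- 1 * cross b1 m1 b2 m2 u r + (- 1 * cross b2 m2 b1 m1 v r
    + sumR b1 (fun j => sumR b2 (fun l =>
        slice_coef b1 m1 j u * slice_coef b2 m2 l v * mono (b1 - j + (b2 - l))%nat r)))))).
  - intros r; rewrite !slice_expand.
    assert (Hc : forall b1 m1 b2 m2 u, cross b1 m1 b2 m2 u r = slice_lead b2 m2 *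
      (sumR b1 (fun j => slice_coef b1 m1 j u * (1 - r) ^ (b1 - j)) * ((1 - r) ^ (b2 + m2 + 1) * r ^ p))).
    { intros; unfold cross, mono; f_equal; rewrite Rmult_comm, <- sumR_scal.
      apply sumR_ext; intros j _; rewrite pow_add; ring. }
    rewrite !Hc.
    assert (Hd : r ^ p * (sumR b1 (fun j => slice_coef b1 m1 j u * (1 - r) ^ (b1 - j))
                          * sumR b2 (fun l => slice_coef b2 m2 l v * (1 - r) ^ (b2 - l)))
      = sumR b1 (fun j => sumR b2 (fun l =>
          slice_coef b1 m1 j u * slice_coef b2 m2 l v * mono (b1 - j + (b2 - l))%nat r))).
    { rewrite sumR_mult, <- sumR_scal; apply sumR_ext; intros j _.
      rewrite <- sumR_scal; apply sumR_ext; intros l _; unfold mono; rewrite pow_add; ring. }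
    rewrite <- Hd; unfold mono; rewrite pow_add; ring.
  - apply is_RInt_Rplus; [apply Hscal, Hmono|].
    apply is_RInt_Rplus; [apply Hscal, Hcross|].
    apply is_RInt_Rplus; [apply Hscal, Hcross|].
    apply (sumR_rel (fun f x => is_RInt f 0 w x)); [exact Hlin|]; intros j _.
    apply (sumR_rel (fun f x => is_RInt f 0 w x)); [exact Hlin|]; intros l _.
    apply Hscal, Hmono.
Qed.

(** The slice with the larger lower limit [u] vanishes for [r > 1 - u]; before that point neither
    slice is cut. *)
Lemma pair_integral_eq (n : nat) (b c : nat -> nat) (u v : R) (i j c1 c2 : nat) :
  0 <= v <= u -> u <= 1 ->
  pair_integral n b c u v i j c1 c2 =
  pair_value (n + 2 * (c1 + c2)) (b i) (2 * c i - 2 * c1) (b j) (2 * c j - 2 * c2) u v (1 - u).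
Proof.
  intros Hv Hu; apply is_RInt_unique.
  rewrite <- (Rplus_0_r (pair_value _ _ _ _ _ _ _ _)).
  apply (is_RInt_chain _ 0 (1 - u) 1).
  - generalize (is_RInt_slice_pair (n + 2 * (c1 + c2)) (b i) (2 * c i - 2 * c1) (b j)
      (2 * c j - 2 * c2) u v (1 - u)).
    apply is_RInt_ext_open; [lra|]; intros r Hr.
    rewrite !cut_slice_above by lra; reflexivity.
  - apply (is_RInt_ext_open (fun _ => 0)); [lra| |apply is_RInt_zero].
    intros r Hr; rewrite (cut_slice_below _ _ u) by lra; ring.
Qed.

Lemma slice_coef_0 (b m j : nat) : slice_coef b m j 0 = 0.
Proof. unfold slice_coef; rewrite pow_i by lia; unfold Rdiv; ring. Qed.

Lemma cross_slice_0 (p b1 m1 b2 m2 : nat) (w : R) : cross_slice p b1 m1 b2 m2 0 w = 0.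
Proof.
  unfold cross_slice; rewrite (sumR_ext _ _ (fun _ => 0)), sumR_0; [ring|].
  intros j _; rewrite slice_coef_0; ring.
Qed.

Lemma pair_value_0r (p b1 m1 b2 m2 : nat) (u w : R) :
  pair_value p b1 m1 b2 m2 u 0 w =
  slice_lead b1 m1 * slice_lead b2 m2 * beta_expand 1 (b1 + m1 + 1 + (b2 + m2 + 1)) p w
  - cross_slice p b1 m1 b2 m2 u w.
Proof.
  unfold pair_value; rewrite cross_slice_0, (sumR_ext b1 _ (fun _ => 0)), sumR_0; [ring|].
  intros j _; rewrite (sumR_ext b2 _ (fun _ => 0)), sumR_0; [ring|].
  intros l _; rewrite (slice_coef_0 b2); ring.
Qed.

(** * Regularised radial integrals *)

Section Defects.
Variables (n : nat) (b c : nat -> nat) (theta : R).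
Hypothesis Htheta : 0 < theta <= 1.
Let k := S (S n).
Let z := theta / 2.

Let Hlin : linear_rel (defect z) := linear_rel_defect z.

Lemma NN_succ (c1 c2 j : nat) : (NN k c1 c2 + j = n + 2 * (c1 + c2) + j + 1)%nat.
Proof. unfold NN, k; lia. Qed.

Lemma DD_neq0 (c1 c2 : nat) : DD k c1 c2 <> 0.
Proof. apply fR_neq0. Qed.

Lemma INR_NN_neq0 (c1 c2 j : nat) : INR (NN k c1 c2 + j) <> 0.
Proof. apply not_0_INR; unfold NN, k; lia. Qed.

(** Term by term, the difference is a combination of [1 - (1 - u) ^ m] with [m = NN k c1 c2 + j],
    and each such power gives a [lam]. *)
Lemma defect_beta_expand (d c1 c2 : nat) :
  defect z (fun u => beta_expand 1 d (n + 2 * (c1 + c2)) 1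
                     + -1 * beta_expand 1 d (n + 2 * (c1 + c2)) (1 - u))
    (sumR d (fun j => (-1) ^ j * Binomial.C d j / INR (NN k c1 c2 + j) * lam theta (NN k c1 c2 + j))).
Proof.
  apply (defect_ext z (fun u => sumR d (fun j =>
    (-1) ^ j * Binomial.C d j / INR (NN k c1 c2 + j) * (1 - (1 - u) ^ (NN k c1 c2 + j))))).
  - intros u _; unfold beta_expand; rewrite <- sumR_scal, <- sumR_plus.
    apply sumR_ext; intros j _; rewrite NN_succ, !pow1; unfold Rdiv; ring.
  - apply sumR_rel; [exact Hlin|]; intros j _; apply (proj2 Hlin).
    rewrite NN_succ, Nat.add_1_r; apply defect_lam, Htheta.
Qed.

Lemma defect_pow_beta_expand (q d c1 c2 : nat) :
  defect z (fun u => u ^ (q + 1) * beta_expand 1 d (n + 2 * (c1 + c2)) (1 - u))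
    (sumR d (fun j => (-1) ^ j * Binomial.C d j / INR (NN k c1 c2 + j)
                      * - mu theta (q + 1) (NN k c1 c2 + j))).
Proof.
  apply (defect_ext z (fun u => sumR d (fun j =>
    (-1) ^ j * Binomial.C d j / INR (NN k c1 c2 + j) * (u ^ (q + 1) * (1 - u) ^ (NN k c1 c2 + j))))).
  - intros u _; unfold beta_expand; rewrite <- sumR_scal.
    apply sumR_ext; intros j _; rewrite NN_succ, !pow1; unfold Rdiv; ring.
  - apply sumR_rel; [exact Hlin|]; intros j _; apply (proj2 Hlin).
    rewrite (Nat.add_1_r q); apply defect_mu, Htheta.
Qed.

(** The product of the two leading coefficients is [delta], and the degree [d] is the bound
    [dtil]. *)
Lemma defect_term1 (i j c1 c2 : nat) :
  let p := (n + 2 * (c1 + c2))%nat in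
  let m1 := (2 * c i - 2 * c1)%nat in let m2 := (2 * c j - 2 * c2)%nat in
  let d := (b i + m1 + 1 + (b j + m2 + 1))%nat in
  defect z (fun u => / DD k c1 c2 * (slice_lead (b i) m1 * slice_lead (b j) m2) *
                     (beta_expand 1 d p 1 + -1 * beta_expand 1 d p (1 - u)))
    (term1 k b c theta i j c1 c2).
Proof.
  intros p m1 m2 d.
  replace (term1 _ _ _ _ _ _ _ _) with (/ DD k c1 c2 * (slice_lead (b i) m1 * slice_lead (b j) m2) *
    sumR d (fun l => (-1) ^ l * Binomial.C d l / INR (NN k c1 c2 + l) * lam theta (NN k c1 c2 + l))).
  - apply (proj2 Hlin), defect_beta_expand.
  - unfold term1; replace (dtil b c i j c1 c2) with d by (unfold d, m1, m2, dtil; lia).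
    rewrite <- sumR_scal; apply sumR_ext; intros l _.
    unfold slice_lead, delta; fold m1 m2.
    assert (H := INR_NN_neq0 c1 c2 l); assert (H' := DD_neq0 c1 c2).
    field; repeat split; auto; apply fR_neq0.
Qed.

(** The factor [slice_lead] times the denominator in [slice_coef] gives [eps]; the sign on the right
    comes from [defect_mu]. *)
Lemma defect_term2 (i j c1 c2 : nat) :
  defect z (fun u => / DD k c1 c2 * cross_slice (n + 2 * (c1 + c2)) (b i) (2 * c i - 2 * c1)
                                    (b j) (2 * c j - 2 * c2) u (1 - u))
    (- term2 k b c theta i j c1 c2).
Proof.
  set (m1 := (2 * c i - 2 * c1)%nat); set (m2 := (2 * c j - 2 * c2)%nat).
  set (p := (n + 2 * (c1 + c2))%nat).
  set (e := fun x => (b i - x + (b j + m2 + 1))%nat).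
  apply (defect_ext z (fun u => sumR (b i) (fun x =>
    / DD k c1 c2 * slice_lead (b j) m2 * (Binomial.C (b i) x * (-1) ^ x / INR (m1 + x + 1)) *
    (u ^ (m1 + x + 1) * beta_expand 1 (e x) p (1 - u))))).
  - intros u _; unfold cross_slice; rewrite <- Rmult_assoc, <- sumR_scal.
    apply sumR_ext; intros x _; unfold slice_coef, e, Rdiv; ring.
  - replace (- term2 _ _ _ _ _ _ _ _) with (sumR (b i) (fun x =>
      / DD k c1 c2 * slice_lead (b j) m2 * (Binomial.C (b i) x * (-1) ^ x / INR (m1 + x + 1)) *
      sumR (e x) (fun l => (-1) ^ l * Binomial.C (e x) l / INR (NN k c1 c2 + l)
                           * - mu theta (m1 + x + 1) (NN k c1 c2 + l)))).
    + apply sumR_rel; [exact Hlin|]; intros x _; apply (proj2 Hlin), defect_pow_beta_expand.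
    + unfold term2; rewrite <- sumR_opp; apply sumR_ext; intros x _.
      replace (etil b c i j c2 x) with (e x) by (unfold e, m2, etil; lia).
      rewrite <- sumR_opp, <- sumR_scal; apply sumR_ext; intros l _.
      unfold slice_lead, eps; fold m1 m2; rewrite pow_add, !(Nat.add_comm x m1).
      assert (H := INR_NN_neq0 c1 c2 l); assert (H' := DD_neq0 c1 c2).
      field; repeat split; auto; try apply fR_neq0; apply not_0_INR; lia.
Qed.

(** The two powers of [u] combine into the first index of [mu], and the two denominators into
    [zeta]. *)
Lemma defect_term3 (i j c1 c2 : nat) :
  let m1 := (2 * c i - 2 * c1)%nat in let m2 := (2 * c j - 2 * c2)%nat in
  defect z (fun u => / DD k c1 c2 * sumR (b i) (fun x => sumR (b j) (fun y =>
      slice_coef (b i) m1 x u * slice_coef (b j) m2 y u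
      * beta_expand 1 (b i - x + (b j - y)) (n + 2 * (c1 + c2)) (1 - u))))
    (- term3 k b c theta i j c1 c2).
Proof.
  intros m1 m2; set (p := (n + 2 * (c1 + c2))%nat).
  set (co := fun x y => / DD k c1 c2 * (Binomial.C (b i) x * (-1) ^ x / INR (m1 + x + 1)
                                     * (Binomial.C (b j) y * (-1) ^ y / INR (m2 + y + 1)))).
  apply (defect_ext z (fun u => sumR (b i) (fun x => sumR (b j) (fun y =>
    co x y * (u ^ (m1 + x + m2 + y + 1 + 1) * beta_expand 1 (b i - x + (b j - y)) p (1 - u)))))).
  - intros u _; rewrite <- sumR_scal; apply sumR_ext; intros x _.
    rewrite <- sumR_scal; apply sumR_ext; intros y _; unfold co, slice_coef, Rdiv.
    replace (m1 + x + m2 + y + 1 + 1)%nat with (m1 + x + 1 + (m2 + y + 1))%nat by lia.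
    rewrite pow_add; ring.
  - replace (- term3 _ _ _ _ _ _ _ _) with (sumR (b i) (fun x => sumR (b j) (fun y =>
      co x y * sumR (b i - x + (b j - y)) (fun l =>
        (-1) ^ l * Binomial.C (b i - x + (b j - y)) l / INR (NN k c1 c2 + l)
        * - mu theta (m1 + x + m2 + y + 1 + 1) (NN k c1 c2 + l))))).
    + apply sumR_rel; [exact Hlin|]; intros x _.
      apply sumR_rel; [exact Hlin|]; intros y _.
      apply (proj2 Hlin), defect_pow_beta_expand.
    + unfold term3; rewrite <- sumR_opp; apply sumR_ext; intros x _.
      rewrite <- sumR_opp; apply sumR_ext; intros y _.
      rewrite <- sumR_opp, <- sumR_scal; apply sumR_ext; intros l _.
      unfold co, zeta, ftil; fold m1 m2; rewrite !pow_add.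
      replace (m1 + m2 + x + y + 2)%nat with (m1 + x + m2 + y + 1 + 1)%nat by lia.
      rewrite (Nat.add_comm x m1), (Nat.add_comm y m2).
      assert (H := INR_NN_neq0 c1 c2 l); assert (H' := DD_neq0 c1 c2).
      field; repeat split; auto; apply not_0_INR; lia.
Qed.

(** With second lower limit 0 only the top product and one mixed part survive. *)
Lemma defect_L (i j c1 c2 : nat) :
  defect z (fun u => pair_integral n b c 0 0 i j c1 c2 / DD k c1 c2
                     - pair_integral n b c u 0 i j c1 c2 / DD k c1 c2)
    (term1 k b c theta i j c1 c2 - term2 k b c theta i j c1 c2).
Proof.
  generalize (proj1 Hlin _ _ _ _ (defect_term1 i j c1 c2) (defect_term2 i j c1 c2)).
  apply defect_ext; intros u Hu.
  rewrite !pair_integral_eq by lra; rewrite !pair_value_0r, cross_slice_0, (Rminus_0_r 1).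
  unfold Rdiv; ring.
Qed.

(** The second mixed part is [term2] with [(i, c1)] and [(j, c2)] exchanged. The lower product
    enters the difference with a minus sign, which cancels the one in [defect_term3]. *)
Lemma defect_M (i j c1 c2 : nat) :
  defect z (fun u => pair_integral n b c 0 0 i j c1 c2 / DD k c1 c2
                     - pair_integral n b c u u i j c1 c2 / DD k c1 c2)
    (term1 k b c theta i j c1 c2 - term2 k b c theta i j c1 c2 + term3 k b c theta i j c1 c2
     + -1 * term2 k b c theta j i c2 c1).
Proof.
  replace (_ + _) with (term1 k b c theta i j c1 c2 + (- term2 k b c theta i j c1 c2
    + (- term2 k b c theta j i c2 c1 + -1 * - term3 k b c theta i j c1 c2))) by ring.
  generalize (proj1 Hlin _ _ _ _ (defect_term1 i j c1 c2)
    (proj1 Hlin _ _ _ _ (defect_term2 i j c1 c2)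
    (proj1 Hlin _ _ _ _ (defect_term2 j i c2 c1)
      (proj2 Hlin (-1) _ _ (defect_term3 i j c1 c2))))).
  apply defect_ext; intros u Hu.
  rewrite !pair_integral_eq by lra; rewrite pair_value_0r, cross_slice_0, (Rminus_0_r 1).
  unfold pair_value; rewrite (Nat.add_comm c2 c1).
  replace (DD k c2 c1) with (DD k c1 c2) by (unfold DD; f_equal; lia).
  unfold Rdiv; ring.
Qed.

End Defects.

(** * Linearity and symmetry of the outer sum *)

Section Outer.
Variables (k s : nat) (a : nat -> R) (c : nat -> nat).

Lemma outer_rel {X : Type} (P : (X -> R) -> R -> Prop)
  (f : X -> nat -> nat -> nat -> nat -> R) (v : nat -> nat -> nat -> nat -> R) :
  linear_rel P -> (forall i j c1 c2, P (fun x => f x i j c1 c2) (v i j c1 c2)) ->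
  P (fun x => outer k s a c (f x)) (outer k s a c v).
Proof.
  intros Hlin H; unfold outer.
  apply sumR_rel; [exact Hlin|]; intros i _.
  apply sumR_rel; [exact Hlin|]; intros j _; apply (proj2 Hlin).
  apply sumR_rel; [exact Hlin|]; intros c1 _.
  apply sumR_rel; [exact Hlin|]; intros c2 _; apply (proj2 Hlin), H.
Qed.

Lemma outer_axpy (x : R) (f g : nat -> nat -> nat -> nat -> R) :
  outer k s a c (fun i j c1 c2 => f i j c1 c2 + x * g i j c1 c2)
  = outer k s a c f + x * outer k s a c g.
Proof.
  symmetry.
  (* A pair of families is encoded as a family over [bool], so that additivity of [outer] is an
     instance of [outer_rel]. *)
  apply (outer_rel (fun (h : bool -> R) w => h true + x * h false = w)
    (fun t => if t then f else g) (fun i j c1 c2 => f i j c1 c2 + x * g i j c1 c2)).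
  - split; [intros h h' u v <- <- | intros y h u <-]; ring.
  - reflexivity.
Qed.

Lemma outer_ext (f g : nat -> nat -> nat -> nat -> R) :
  (forall i j c1 c2, f i j c1 c2 = g i j c1 c2) -> outer k s a c f = outer k s a c g.
Proof.
  intros H; unfold outer.
  apply sumR_ext; intros i _; apply sumR_ext; intros j _; f_equal.
  apply sumR_ext; intros c1 _; apply sumR_ext; intros c2 _; now rewrite H.
Qed.

(** The weights are symmetric under exchanging [(i, c1)] with [(j, c2)]; this merges the two mixed
    parts of [M_k] into twice [term2]. *)
Lemma outer_swap (f : nat -> nat -> nat -> nat -> R) :
  outer k s a c (fun i j c1 c2 => f j i c2 c1) = outer k s a c f.
Proof.
  unfold outer; rewrite sumR_swap.
  apply sumR_ext; intros i _; apply sumR_ext; intros j _.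
  rewrite sumR_swap, (Rmult_comm (a j)); f_equal.
  apply sumR_ext; intros c1 _; apply sumR_ext; intros c2 _.
  rewrite (Nat.add_comm c2), (Rmult_comm (Binomial.C (c j) c2)); reflexivity.
Qed.

End Outer.

(** * The limits of the regularised functionals *)

Theorem theorem4 (k : nat) (theta : R) (s : nat) (a : nat -> R) (b c : nat -> nat) :
  (2 <= k)%nat -> 0 < theta <= 1 ->
  filterlim (fun eta => Lk k s a b c theta eta
               - theta / 2 * ln ((1 - eta) / (eta * (2 / theta - 1))) * Jk k s a b c)
    (at_right 0) (locally (Ltilde_formula k s a b c theta)) /\
  filterlim (fun eta => Mk k s a b c theta eta
               - theta ^ 2 / 4 * ln ((1 - eta) / (eta * (2 / theta - 1))) * Jk k s a b c)
    (at_right 0) (locally (Mtilde_formula k s a b c theta)).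
Proof.
  intros Hk Ht.
  destruct k as [|[|n]]; try lia; clear Hk.
  set (k := S (S n)); set (z := theta / 2).
  assert (Hz : 0 < z <= / 2) by (unfold z; lra).
  replace (2 / theta) with (/ z) by (unfold z; field; lra).
  replace (theta ^ 2 / 4) with (z * z) by (unfold z; field).
  (* [E] collects the radial integrals without the prefactors [/ (1 - u)] and [/ (1 - v)]; [J_k],
     [L_k] and [M_k] involve [E 0 0], [E u 0] and [E u u]. *)
  set (E := fun u v => outer k s a c (fun i j c1 c2 =>
    pair_integral n b c u v i j c1 c2 / DD k c1 c2)).
  assert (HE : forall u v, 0 <= u < 1 -> 0 <= v < 1 ->
    iint (k - 1) (fun y => fiber k s a b c u y * fiber k s a b c v y) = / (1 - u) * / (1 - v) * E u v).
  { intros u v Hu Hv; apply is_iint_unique, is_iint_fiber_mult; assumption. }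
  assert (Hiext : forall f g : (nat -> R) -> R, (forall y, f y = g y) -> iint (k - 1) f = iint (k - 1) g).
  { generalize (k - 1)%nat as m; induction m as [|m IH]; intros f g H; simpl; [apply H|].
    apply RInt_ext; intros t _; apply IH; auto. }
  assert (HJ : Jk k s a b c = E 0 0).
  { unfold Jk; rewrite (Hiext _ (fun y => fiber k s a b c 0 y * fiber k s a b c 0 y)).
    - rewrite HE by lra; field.
    - intros y; rewrite innerF_fiber; ring. }
  rewrite HJ.
  assert (Hxi : forall xi, 0 < xi < z -> 0 < xi / z < 1).
  { intros xi Hxi; split; [apply Rdiv_lt_0_compat; lra|].
    apply (Rmult_lt_reg_r z); [lra|]; field_simplify; lra. }
  assert (Hfib : forall xi y, innerFxi k s a b c theta xi y = fiber k s a b c (xi / z) y).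
  { intros xi y; unfold fiber, z; replace (xi / (theta / 2)) with (2 * xi / theta) by (field; lra).
    reflexivity. }
  assert (Hminus : forall u v, E 0 0 - E u v = outer k s a c (fun i j c1 c2 =>
      pair_integral n b c 0 0 i j c1 c2 / DD k c1 c2 - pair_integral n b c u v i j c1 c2 / DD k c1 c2)).
  { intros u v; transitivity (E 0 0 + -1 * E u v); [ring|]; unfold E; rewrite <- outer_axpy.
    apply outer_ext; intros; ring. }
  split.
  - apply (filterlim_defect z (E 0 0) _ (fun u => E u 0) (fun u => E 0 0 - E u 0)); auto.
    + apply (defect_ext z (fun u => outer k s a c (fun i j c1 c2 =>
        pair_integral n b c 0 0 i j c1 c2 / DD k c1 c2 - pair_integral n b c u 0 i j c1 c2 / DD k c1 c2))).
      * intros u _; symmetry; apply Hminus.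
      * apply (outer_rel k s a c (defect z)); [apply linear_rel_defect|]; intros; apply defect_L, Ht.
    + intros xi H; specialize (Hxi xi H).
      rewrite (Hiext _ (fun y => fiber k s a b c (xi / z) y * fiber k s a b c 0 y))
        by (intros y; now rewrite Hfib, innerF_fiber).
      rewrite HE by lra.
      (* The factor [1 - xi / z] extracted from the weight cancels the prefactor of the fibre. *)
      change (theta / 2) with z; replace (z - xi) with (z * (1 - xi / z)) by (field; lra).
      cbv beta; revert Hxi; generalize (xi / z); intros w Hw; field; repeat split; lra.
  (* One factor [z] moves into [E], since the squared weight leaves [z * z] after cancelling both
     fibre prefactors. *)
  - apply (filterlim_ext (fun eta => Mk k s a b c theta eta
      - z * ln ((1 - eta) / (eta * (/ z - 1))) * (z * E 0 0))); [intros; ring|].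
    apply (filterlim_defect z (z * E 0 0) _ (fun u => z * E u u) (fun u => z * (E 0 0 - E u u))); auto.
    + apply (proj2 (linear_rel_defect z)).
      apply (defect_ext z (fun u => outer k s a c (fun i j c1 c2 =>
        pair_integral n b c 0 0 i j c1 c2 / DD k c1 c2 - pair_integral n b c u u i j c1 c2 / DD k c1 c2))).
      * intros u _; symmetry; apply Hminus.
      * assert (HV : outer k s a c (fun i j c1 c2 =>
          term1 k b c theta i j c1 c2 - term2 k b c theta i j c1 c2 + term3 k b c theta i j c1 c2
          + -1 * term2 k b c theta j i c2 c1) = outer k s a c (fun i j c1 c2 =>
          term1 k b c theta i j c1 c2 - 2 * term2 k b c theta i j c1 c2 + term3 k b c theta i j c1 c2)).
        { rewrite (outer_axpy k s a c (-1) (fun i j c1 c2 => term1 k b c theta i j c1 c2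
            - term2 k b c theta i j c1 c2 + term3 k b c theta i j c1 c2)
            (fun i j c1 c2 => term2 k b c theta j i c2 c1)), (outer_swap k s a c (term2 k b c theta)), <- outer_axpy.
          apply outer_ext; intros; ring. }
        rewrite <- HV; apply (outer_rel k s a c (defect z)); [apply linear_rel_defect|]; intros; apply defect_M, Ht.
    + intros; ring.
    + intros xi H; specialize (Hxi xi H).
      rewrite (Hiext _ (fun y => fiber k s a b c (xi / z) y * fiber k s a b c (xi / z) y))
        by (intros y; rewrite Hfib; ring).
      rewrite HE by lra.
      change (theta / 2) with z; replace (z - xi) with (z * (1 - xi / z)) by (field; lra).
      cbv beta; revert Hxi; generalize (xi / z); intros w Hw; field; repeat split; lra.
Qed.
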